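(* Let $G$ be a locally compact group and let $(\Phi,\Psi)$ be a complementary pair of Young functions such that both $\Phi$ and $\Psi$ satisfy the $\Delta_2$-condition and both satisfy the MA condition. Let $X$ be a norm closed topologically invariant subspace of $PM_\Psi(G)$ that contains $T_\mu$ for every $\mu\in M_1^+(G)$. Suppose that $\|T_\mu\|_{PM_\Psi}\le 1$ for all $\mu\in M_1^+(G)$ and that $\eta[(\overline{A_\Phi\cdot X})^\ast]$ contains the identity injection $I\in\mathcal{M}(X,PM_\Psi)$, $I(\varphi)=\varphi$ (in particular, this last hypothesis holds if $\eta$ is surjective). Then $G$ is amenable.
   Context: $G$ carries a fixed left Haar measure $dx$. A Young function is a symmetric convex $\Phi:\mathbb{R}\to[0,\infty]$ with $\Phi(0)=0$ and $\lim_{x\to\infty}\Phi(x)=+\infty$; its complementary function is $\Psi(y)=\sup\{x|y|-\Phi(x):x\ge 0\}$. $\Phi$ satisfies the $\Delta_2$-condition if there are $k>0$ and $x_0$ with $\Phi(2x)\le k\,\Phi(x)$ for all $x\ge x_0$, where $x_0>0$ if $G$ is compact and $x_0=0$ if $G$ is non-compact. $\Phi$ satisfies the MA (Milnes-Akimovič) condition if for each $\epsilon>0$ there are $\alpha_\epsilon>1$ and $x_1(\epsilon)\ge 0$ with $\Phi'((1+\epsilon)x)\ge\alpha_\epsilon\Phi'(x)$ for $x\ge x_1(\epsilon)$. $L^\Phi(G)$ is the space of measurable $f:G\to\mathbb{C}$ (mod a.e. equality) with $\int_G\Phi(\alpha|f|)<\infty$ for some $\alpha>0$; $N_\Phi(f)=\inf\{a>0:\int_G\Phi(|f|/a)\le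 1\}$ and $\|f\|_\Phi=\sup\{\int_G|fg|:g\in L^\Psi(G),\int_G\Psi(|g|)\le1\}$. Here $L^\Phi(G)$ carries $N_\Phi$ and $L^\Psi(G)$ carries $\|\cdot\|_\Psi$. With $\check g(x)=g(x^{-1})$, $A_\Phi(G)$ is the space of continuous functions $u=\sum_n f_n*\check g_n$ with $f_n\in L^\Phi(G)$, $g_n\in L^\Psi(G)$, $\sum_n N_\Phi(f_n)\|g_n\|_\Psi<\infty$, normed by the infimum of such sums over all representations; it is a commutative Banach algebra under pointwise operations. $M(G)$ is the space of bounded complex Radon measures on $G$; for $\mu\in M(G)$, $T_\mu(f)=\mu*f$ on $L^\Psi(G)$. $PM_\Psi(G)$ is the closure of $\{T_\mu:\mu\in M(G)\}$ in $\mathcal{B}(L^\Psi(G))$ for the ultraweak ($w^\ast$-) topology, with the operator norm $\|\cdot\|_{PM_\Psi}$; it is isometrically the dual of $A_\Phi(G)$ via $\langle u,T\rangle=\sum_n\int_G f_n\,T(g_n)$ for $u=\sum_n f_n*\check g_n$, so $\langle u,T_\mu\rangle=\int_G u\,d\mu$. $M_1^+(G)=\{\mu\in M(G):\mu\ge 0,\ \mu(G)=1\}$. $A_\Phi(G)$ acts on $PM_\Psi(G)$ by $\langle v,u\cdot\varphi\rangle=\langle uv,\varphi\rangle$. A closed subspace $X\subseteq PM_\Psi(G)$ is topologically invariant if $u\cdot\varphi\in X$ for all $u\in A_\Phi(G)$, $\varphi\in X$. $\overline{A_\Phi\cdot X}$ is the norm closure of the linear span of $\{u\cdot\varphi:u\in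 A_\Phi(G),\varphi\in X\}$. $\mathcal{M}(X,PM_\Psi)$ is the space of bounded linear $T:X\to PM_\Psi(G)$ with $T(u\cdot\varphi)=u\cdot T(\varphi)$ for all $u\in A_\Phi(G)$, $\varphi\in X$. The map $\eta:(\overline{A_\Phi\cdot X})^\ast\to\mathcal{M}(X,PM_\Psi)$ is $\eta(m)(\varphi)=m\odot\varphi$, where $m\odot\varphi\in PM_\Psi(G)$ is given by $\langle u,m\odot\varphi\rangle=\langle u\cdot\varphi,m\rangle$ for $u\in A_\Phi(G)$. $G$ is amenable if there is a positive norm-one linear functional on $L^\infty(G)$ invariant under left translations. *)

(* Defs.v *)
From HB Require Import structures.
From mathcomp Require Import all_boot all_order all_algebra.
From mathcomp Require Import all_classical all_reals all_analysis.
From mathcomp Require Import complex.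

Set Implicit Arguments.
Unset Strict Implicit.
Unset Printing Implicit Defensive.

Import Order.TTheory GRing.Theory Num.Theory.
Import numFieldNormedType.Exports.

Local Open Scope classical_set_scope.
Local Open Scope ring_scope.
Local Open Scope complex_scope.

(* Every element of [L^Phi(G)] and of [L^oo(G)] is represented by an everywhere
   defined Borel function [G -> R[i]], and every operator on [L^Psi(G)] by a map
   on such functions. Equality in the quotient spaces is equality almost
   everywhere (locally almost everywhere for [L^oo]), and all norms below are
   the corresponding (extended-real valued) seminorms. *)

HB.mixin Record isTopologicalGroup G of Group G & PointedTopological G := {
  mulg_continuous : continuous (fun xy : G * G => (xy.1 * xy.2)%g) ;
  invg_continuous : continuous (fun x : G => (x^-1)%g)
}.

#[short(type="topGroupType")]
HB.structure Definition TopologicalGroup :=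
  {G of isTopologicalGroup G & Group G & PointedTopological G}.

Notation borel G := (g_sigma_algebraType (@open G)).

Section Young.
Context {R : realType}.
Implicit Types Phi Psi : R -> \bar R.
Local Open Scope ereal_scope.

Definition young_function Phi :=
  [/\ forall x, 0 <= Phi x,
      Phi 0%R = 0,
      forall x, Phi (- x)%R = Phi x,
      forall (t x y : R), (0 <= t <= 1)%R ->
        Phi (t * x + (1 - t) * y)%R <= t%:E * Phi x + (1 - t)%:E * Phi y &
      Phi x @[x --> +oo%R] --> +oo].

Definition complementary Phi (y : R) : \bar R :=
  ereal_sup [set (x * `|y|)%:E - Phi x | x in [set x : R | (0 <= x)%R]].

Definition complementary_pair Phi Psi :=
  [/\ young_function Phi, young_function Psi &
      forall y, Psi y = complementary Phi y].

Definition delta2 (G : topologicalType) Phi :=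
  exists k x0 : R,
    [/\ (0 < k)%R,
        compact [set: G] -> (0 < x0)%R,
        ~ compact [set: G] -> x0 = 0%R &
        forall x, (x0 <= x)%R -> Phi (2 * x)%R <= k%:E * Phi x].

(* A convex function need not be differentiable everywhere; [Phi'] is its left
   derivative. Where [Phi x = +oo] the quotient below is [+oo], since
   [h < 0] and [_ - +oo = -oo]. *)
Definition left_derivative Phi (x : R) : \bar R :=
  lim ((Phi (x + h)%R - Phi x) * (h^-1)%:E @[h --> (0:R)^'-]).

Definition milnes_akimovic Phi :=
  forall e : R, (0 < e)%R ->
  exists a x1 : R,
    [/\ (1 < a)%R, (0 <= x1)%R &
        forall x, (x1 <= x)%R ->
          a%:E * left_derivative Phi x <= left_derivative Phi ((1 + e) * x)%R].

End Young.

Section Measures.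
Context {R : realType} {G : topGroupType}.

Definition left_haar (mu : {measure set (borel G) -> \bar R}) :=
  [/\ mu setT != 0%E,
      forall K : set G, compact K -> (mu K < +oo)%E,
      forall A : set (borel G), measurable A ->
        mu A = ereal_inf [set mu U | U in [set U : set G | open U /\ A `<=` U]],
      forall U : set G, open U ->
        mu U = ereal_sup [set mu K | K in [set K : set G | compact K /\ K `<=` U]] &
      forall (x : G) (A : set (borel G)), measurable A ->
        mu [set (x * y)%g | y in A] = mu A].

Definition complex_measurable (f : G -> R[i]) :=
  measurable_fun [set: borel G] (fun x => complex.Re (f x)) /\
  measurable_fun [set: borel G] (fun x => complex.Im (f x)).

Definition complex_continuous (f : G -> R[i]) :=
  continuous (fun x => complex.Re (f x)) /\
  continuous (fun x => complex.Im (f x)).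

Definition modulus (f : G -> R[i]) (x : G) : R := Normc.normc (f x).

Definition cintegral (mu : {measure set (borel G) -> \bar R})
    (f : G -> R[i]) : R[i] :=
  (\int[mu]_x complex.Re (f x)) +i* (\int[mu]_x complex.Im (f x)).

Definition hahn_sets (nu : {charge set (borel G) -> \bar R}) :
    {PN : set (borel G) * set (borel G) | hahn_decomposition nu PN.1 PN.2}.
Proof.
by apply: cid; have [P [N PN]] := Hahn_decomposition nu; exists (P, N).
Defined.

Definition pos_part (nu : {charge set (borel G) -> \bar R}) :
  {measure set (borel G) -> \bar R} := jordan_pos (projT2 (hahn_sets nu)).

Definition neg_part (nu : {charge set (borel G) -> \bar R}) :
  {measure set (borel G) -> \bar R} := jordan_neg (projT2 (hahn_sets nu)).

Definition variation (nu : {charge set (borel G) -> \bar R}) :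
  set (borel G) -> \bar R := charge_variation (projT2 (hahn_sets nu)).

(* The variation is a finite measure, so inner regularity gives outer
   regularity. *)
Definition radon_charge (nu : {charge set (borel G) -> \bar R}) :=
  forall A : set (borel G), measurable A ->
    variation nu A =
    ereal_sup [set variation nu K
              | K in [set K : set G | compact K /\ K `<=` A]].

Record radon_cmeasure := RadonCMeasure {
  re_part : {charge set (borel G) -> \bar R} ;
  im_part : {charge set (borel G) -> \bar R} ;
  re_radon : radon_charge re_part ;
  im_radon : radon_charge im_part
}.

Definition charge_integral (nu : {charge set (borel G) -> \bar R})
    (f : G -> R[i]) : R[i] :=
  cintegral (pos_part nu) f - cintegral (neg_part nu) f.

Definition cmeasure_integral (nu : radon_cmeasure) (f : G -> R[i]) : R[i] :=
  charge_integral (re_part nu) f + (0 +i* 1) * charge_integral (im_part nu) f.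

Definition probability_cmeasure (nu : radon_cmeasure) :=
  [/\ forall A : set (borel G), measurable A -> (0 <= re_part nu A)%E,
      forall A : set (borel G), measurable A -> im_part nu A = 0%E &
      re_part nu setT = 1%E].

End Measures.
Arguments radon_cmeasure R G : clear implicits.

Definition csum {R : realType} (z : nat -> R[i]) : R[i] :=
  limn (series (fun n => complex.Re (z n))) +i*
  limn (series (fun n => complex.Im (z n))).

Section Orlicz.
Context {R : realType} {G : topGroupType}.
Variable mu : {measure set (borel G) -> \bar R}.
Implicit Types (Phi Psi : R -> \bar R) (f g : G -> R[i]).

Definition orlicz_space Phi : set (G -> R[i]) :=
  [set f | complex_measurable f /\
    exists2 a : R, 0 < a & (\int[mu]_x Phi (a * modulus f x)%R < +oo)%E].

Definition luxemburg_norm Phi f : \bar R :=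
  ereal_inf [set a%:E | a in
    [set a : R | 0 < a /\ (\int[mu]_x Phi (modulus f x / a)%R <= 1)%E]].

(* [orlicz_norm Psi f] is [||f||_Phi] for [Psi] the complementary function of
   [Phi]: the supremum runs over the unit modular ball of [L^Psi]. *)
Definition orlicz_norm Psi f : \bar R :=
  ereal_sup [set (\int[mu]_x (Normc.normc (f x * g x)%R)%:E)%E | g in
    [set g | orlicz_space Psi g /\
      (\int[mu]_x Psi (modulus g x) <= 1)%E]].

Definition convolution f g (x : G) : R[i] :=
  cintegral mu (fun y => f y * g (y^-1 * x)%g).

Definition check g (x : G) : R[i] := g (x^-1)%g.

End Orlicz.

Section FigaTalamancaHerz.
Context {R : realType} {G : topGroupType}.
Variables (mu : {measure set (borel G) -> \bar R}) (Phi Psi : R -> \bar R).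

Let LPhi : set (G -> R[i]) := orlicz_space mu Phi.
Let LPsi : set (G -> R[i]) := orlicz_space mu Psi.
Let normPhi (f : G -> R[i]) : \bar R := luxemburg_norm mu Phi f.
Let normPsi (g : G -> R[i]) : \bar R := orlicz_norm mu Phi g.

Definition summable_pair (f g : nat -> G -> R[i]) :=
  [/\ forall n, LPhi (f n), forall n, LPsi (g n) &
      (\sum_(0 <= n <oo) normPhi (f n) * normPsi (g n) < +oo)%E].

Definition represents (f g : nat -> G -> R[i]) (u : G -> R[i]) :=
  summable_pair f g /\
  forall x, u x = csum (fun n => convolution mu (f n) (check (g n)) x).

Definition A_Phi : set (G -> R[i]) :=
  [set u | complex_continuous u /\ exists f g, represents f g u].

Definition op : Type := (G -> R[i]) -> (G -> R[i]).

Definition op_norm (T : op) : \bar R :=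
  ereal_sup [set normPsi (T f) | f in
    [set f | LPsi f /\ (normPsi f <= 1)%E]].

Definition bounded_op : set op := [set T |
  [/\ forall f, LPsi f -> LPsi (T f),
      forall (a : R[i]) f g, LPsi f -> LPsi g ->
        ae_eq mu setT (T (fun x => a * f x + g x))
                      (fun x => a * T f x + T g x) &
      (op_norm T < +oo)%E]].

Definition op_eq (S T : op) := forall f, LPsi f -> ae_eq mu setT (S f) (T f).

Definition op_add (S T : op) : op := fun f x => S f x + T f x.
Definition op_scale (a : R[i]) (T : op) : op := fun f x => a * T f x.
Definition op_sub (S T : op) : op := fun f x => S f x - T f x.

Definition conv_op (nu : radon_cmeasure R G) : op :=
  fun f x => cmeasure_integral nu (fun y => f (y^-1 * x)%g).

Definition trace_functional (f g : nat -> G -> R[i]) (T : op) : R[i] :=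
  csum (fun n => cintegral mu (fun x => f n x * T (g n) x)).

(* The ultraweak topology on bounded operators is generated by the functionals
   [trace_functional f g] with [summable_pair f g]. *)
Definition PM_Psi : set op := [set T |
  bounded_op T /\
  forall (k : nat) (f g : 'I_k -> nat -> G -> R[i]),
    (forall i, summable_pair (f i) (g i)) ->
    forall e : R, 0 < e ->
    exists nu : radon_cmeasure R G, forall i,
      Normc.normc (trace_functional (f i) (g i) (op_sub T (conv_op nu))) < e].

(* The value does not depend on the representation of [u] when [T] is in
   [PM_Psi]; [xget] picks one. *)
Definition pairing (u : G -> R[i]) (T : op) : R[i] :=
  xget 0 [set z | exists f g, represents f g u /\ z = trace_functional f g T].

(* [is_action u phi psi] reads [psi = u . phi]. The premise on [u v] always
   holds, [A_Phi] being an algebra under pointwise operations. *)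
Definition is_action (u : G -> R[i]) (phi psi : op) :=
  PM_Psi psi /\
  forall v, A_Phi v -> A_Phi (fun x => u x * v x) ->
    pairing v psi = pairing (fun x => u x * v x) phi.

Definition op_span (S : set op) : set op := [set T |
  exists (k : nat) (a : 'I_k -> R[i]) (s : 'I_k -> op),
    (forall i, S (s i)) /\ T = (fun f x => \sum_(i < k) a i * s i f x)].

Definition norm_closure (S : set op) : set op := [set T |
  bounded_op T /\
  forall e : R, 0 < e -> exists2 S', S S' & (op_norm (op_sub T S') < e%:E)%E].

Definition closed_subspace (X : set op) :=
  [/\ X `<=` PM_Psi, X (fun _ _ => 0),
      forall a S T, X S -> X T -> X (op_add (op_scale a S) T) &
      norm_closure X `<=` X].

Definition topologically_invariant (X : set op) :=
  forall u phi psi, A_Phi u -> X phi -> is_action u phi psi -> X psi.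

Definition A_dot (X : set op) : set op :=
  norm_closure (op_span [set psi |
    exists u phi, [/\ A_Phi u, X phi & is_action u phi psi]]).

Definition bounded_functional (Y : set op) (m : op -> R[i]) :=
  (forall a S T, Y S -> Y T ->
     m (op_add (op_scale a S) T) = a * m S + m T) /\
  exists C : R, forall T, Y T ->
    ((Normc.normc (m T))%:E <= C%:E * op_norm T)%E.

Definition multipliers (X : set op) : set (op -> op) := [set T |
  [/\ forall phi, X phi -> PM_Psi (T phi),
      forall a phi psi, X phi -> X psi ->
        op_eq (T (op_add (op_scale a phi) psi))
              (op_add (op_scale a (T phi)) (T psi)),
      exists C : R, forall phi, X phi ->
        (op_norm (T phi) <= C%:E * op_norm phi)%E &
      forall u phi psi, A_Phi u -> X phi -> is_action u phi psi ->
        is_action u (T phi) (T psi)]].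

(* [is_odot m phi psi] reads [psi = m (.) phi]. *)
Definition is_odot (m : op -> R[i]) (phi psi : op) :=
  PM_Psi psi /\
  forall u xi, A_Phi u -> is_action u phi xi -> pairing u psi = m xi.

Definition eta_range (X : set op) : set (op -> op) := [set T |
  multipliers X T /\
  exists2 m, bounded_functional (A_dot X) m &
    forall phi, X phi -> is_odot m phi (T phi)].

End FigaTalamancaHerz.

Arguments op R G : clear implicits.

Section Amenability.
Context {R : realType} {G : topGroupType}.
Variable mu : {measure set (borel G) -> \bar R}.

Definition locally_null (N : set G) :=
  forall K : set G, compact K -> mu.-negligible (N `&` K).

Definition Linfty : set (G -> R[i]) := [set f |
  complex_measurable f /\
  exists C : R, locally_null [set x | C < modulus f x]].

Definition ess_norm (f : G -> R[i]) : \bar R :=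
  ereal_inf [set C%:E | C in
    [set C : R | 0 <= C /\ locally_null [set x | C < modulus f x]]].

Definition Linfty_functional (m : (G -> R[i]) -> R[i]) :=
  (forall f g, Linfty f -> Linfty g ->
     locally_null [set x | f x <> g x] -> m f = m g) /\
  (forall a f g, Linfty f -> Linfty g ->
     m (fun x => a * f x + g x) = a * m f + m g).

(* On [R[i]], [0 <= z] means that [z] is a nonnegative real. *)
Definition left_invariant_mean (m : (G -> R[i]) -> R[i]) :=
  [/\ Linfty_functional m,
      forall f, Linfty f -> (forall x, 0 <= f x) -> 0 <= m f,
      ereal_sup [set (Normc.normc (m f))%:E | f in
        [set f | Linfty f /\ (ess_norm f <= 1)%E]] = 1%E &
      forall (x : G) f, Linfty f -> m (fun y => f (x^-1 * y)%g) = m f].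

Definition amenable := exists m, left_invariant_mean m.

End Amenability.

(* Main.v *)
(* A functional m realizing the identity has m(T_nu) = 1 for every finitely
   supported probability nu: some u in A_Phi is 1 on the support of nu, so
   u . T_nu = T_nu and m(T_nu) = <u, T_nu> = nu(G). Hence 1 <= C ||T_nu|| with C
   independent of nu.

   If G is not amenable, Reiter's condition fails in L^1(G), so convolution by
   the uniform measure nu on some finite set has norm < 1 on L^2(G), and its
   powers tend to 0 there. The Delta_2-conditions give
     x y <= d (Phi x + Psi y) + K_d (Phi x)^(1/2) (Psi y)^(1/2),
   which transfers this decay from L^2(G) to the convolution powers of nu on
   L^Psi(G), contradicting the lower bound. No uniform convexity of L^Psi(G)
   is involved. Delta_2 is needed at all x >= 0; this is available when G is
   not compact, and a compact group is amenable by its Haar measure. *)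

Require Import Defs.
From HB Require Import structures.
From mathcomp Require Import all_boot all_order all_algebra.
From mathcomp Require Import all_classical all_reals all_analysis.
From mathcomp Require Import measurable_realfun complex ring lra.

Set Implicit Arguments.
Unset Strict Implicit.
Unset Printing Implicit Defensive.

Import Order.TTheory GRing.Theory Num.Theory.
Import numFieldNormedType.Exports.

Local Open Scope classical_set_scope.
Local Open Scope ring_scope.

(** * Young functions *)

Section FiniteYoung.
Context {R : realType}.
Implicit Types (phi psi : R -> R) (k x y z t : R).

(** The constant [C] is arbitrary, so an operator norm below 1 does not suffice: the norms must be
    driven to 0 while the measures remain finitely supported probabilities. Convolution powers do
    both. No decay is visible in the modulars, because averaging over translates preserves the
    integral of a nonnegative function. It lives in L^2 and comes from strict convexity: for
    [v >= 0] of finite nonzero L^2 norm, the normalized density [v ^+ 2] is moved by some element of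
    the finite set on which Reiter's condition fails, and the average of the translates of [v] then
    loses a fixed proportion of its norm. In the inequality for [x * y], the terms with the factor
    [d] stay small under every power by left invariance of the Haar measure; the product of square
    roots pairs two L^2 functions, and only there is the decay used. Delta_2 also bounds the modular
    on the unit ball of [L^Psi(G)], which turns the estimate into one of operator norms. Finite
    support makes [<u, T_nu>] a finite sum of values of [u], computed by linearity instead of
    Fubini's theorem. *)

Definition convex_fun phi := forall t x y, 0 <= t <= 1 ->
  phi (t * x + (1 - t) * y) <= t * phi x + (1 - t) * phi y.

(** Doubling is asked at every [x >= 0], with a constant [k] that both functions of a pair share. *)
Record young_fun k phi : Prop := {
  young_ge0 : forall x, 0 <= phi x ;
  young_0 : phi 0 = 0 ;
  young_even : forall x, phi (- x) = phi x ;
  young_convex : convex_fun phi ;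
  young_double : forall x, 0 <= x -> phi (2 * x) <= k * phi x
}.

(** The two fields together say that [psi y] is the supremum of [x * y - phi x]: an upper bound, and
    the least one. *)
Record conj_fun phi psi : Prop := {
  conj_young : forall x y, 0 <= x -> 0 <= y -> x * y <= phi x + psi y ;
  conj_sup : forall y c, 0 <= y ->
    (forall x, 0 <= x -> x * y - phi x <= c) -> psi y <= c
}.

Lemma young_contract k phi t x : young_fun k phi -> 0 <= t <= 1 ->
  phi (t * x) <= t * phi x.
Proof.
move=> yphi t01; have := young_convex yphi x 0 t01.
by rewrite !mulr0 (young_0 yphi) mulr0 !addr0.
Qed.

Lemma young_dilate k phi t x : young_fun k phi -> 1 <= t ->
  t * phi x <= phi (t * x).
Proof.
move=> yphi t1; have t0 : 0 < t by apply: lt_le_trans t1.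
have ht : 0 <= t^-1 <= 1 by rewrite invr_ge0 (ltW t0) invf_le1.
have := young_contract (t * x) yphi ht; rewrite mulKf ?gt_eqF // => h.
by rewrite -ler_pdivlMl.
Qed.

Lemma young_mono k phi x y : young_fun k phi -> 0 <= x -> x <= y ->
  phi x <= phi y.
Proof.
move=> yphi x0 xy; have [->|/eqP x_neq0] := eqVneq x 0.
  by rewrite (young_0 yphi) (young_ge0 yphi).
have y0 : 0 < y by apply: lt_le_trans xy; rewrite lt_def x0 andbT; apply/eqP.
have t01 : 0 <= x / y <= 1 by rewrite divr_ge0 ?(ltW y0)//= ler_pdivrMr ?mul1r.
have := young_contract y yphi t01; rewrite divfK ?gt_eqF // => /le_trans; apply.
rewrite ler_piMl ?(young_ge0 yphi)//; by case/andP: t01.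
Qed.

Lemma young_pow2 k phi x j : young_fun k phi -> 0 <= k -> 0 <= x ->
  phi (2 ^+ j * x) <= k ^+ j * phi x.
Proof.
move=> yphi k0 x0; elim: j => [|j IH]; first by rewrite !expr0 !mul1r.
rewrite !exprS -!mulrA.
apply: le_trans (young_double yphi _) _; first by rewrite mulr_ge0 // exprn_ge0.
by rewrite ler_wpM2l.
Qed.

(* Young's inequality for the pairs (x, 2^j y) and (2^j x, y): the larger of
   [phi x] and [psi y] receives the factor 2^-j and the smaller one is at most
   their geometric mean. *)
Lemma young_sqrt k phi psi d : young_fun k phi -> young_fun k psi ->
  conj_fun phi psi -> 0 < k -> 0 < d ->
  exists2 K, 0 <= K & forall x y, 0 <= x -> 0 <= y ->
    x * y <= d * (phi x + psi y) + K * (Num.sqrt (phi x) * Num.sqrt (psi y)).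
Proof.
move=> yphi ypsi cpp k0 d0.
have [j hj] : exists j, d^-1 <= 2 ^+ j.
  exists (Num.bound d^-1); apply: ltW.
  have h : d^-1 < (Num.bound d^-1)%:R.
    by apply: archi_boundP; rewrite invr_ge0 ltW.
  apply: lt_trans h _; by rewrite -natrX ltr_nat ltn_expl.
have p0 : 0 < 2 ^+ j :> R by apply: exprn_gt0.
have hd : (2 ^+ j)^-1 <= d by rewrite invf_ple ?posrE.
exists (k ^+ j / 2 ^+ j) => [|x y x0 y0].
  by rewrite divr_ge0 // exprn_ge0 // ltW.
have kj0 : 0 <= k ^+ j by rewrite exprn_ge0 // ltW.
have aux a b : 0 <= a -> 0 <= b -> b <= a ->
   2 ^+ j * (x * y) <= a + k ^+ j * b ->
   x * y <= d * (a + b) + k ^+ j / 2 ^+ j * (Num.sqrt a * Num.sqrt b).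
  move=> a0 b0 ba h.
  have hs : b <= Num.sqrt a * Num.sqrt b.
    rewrite -{1}(sqr_sqrtr b0) expr2 ler_wpM2r ?sqrtr_ge0 //.
    by rewrite ler_sqrt // (le_trans b0 ba).
  rewrite -(ler_pM2l p0); apply: le_trans h _.
  rewrite mulrDr; apply: lerD.
    rewrite mulrA; apply: le_trans (_ : 1 * (a + b) <= _).
      by rewrite mul1r lerDl.
    by rewrite ler_wpM2r ?addr_ge0 // mulrC -ler_pdivrMr // mul1r.
  rewrite [leRHS](_ : _ = k ^+ j * (Num.sqrt a * Num.sqrt b)).
    by rewrite ler_wpM2l.
  by field; rewrite gt_eqF.
have [ba|ab] := leP (psi y) (phi x).
  apply: aux; rewrite ?(young_ge0 yphi) ?(young_ge0 ypsi) //.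
  rewrite mulrCA; apply: le_trans (conj_young cpp x0 _) _.
    by rewrite mulr_ge0 // ltW.
  by rewrite lerD2l; apply: young_pow2 => //; apply: ltW.
rewrite [phi x + _]addrC [Num.sqrt _ * _]mulrC.
apply: aux; rewrite ?(young_ge0 yphi) ?(young_ge0 ypsi) ?(ltW ab) //.
rewrite mulrA addrC; apply: le_trans (conj_young cpp _ y0) _.
  by rewrite mulr_ge0 // ltW.
by rewrite lerD2r; apply: young_pow2 => //; apply: ltW.
Qed.

Lemma convex_fun_slope phi x y z : convex_fun phi -> z < x -> x < y ->
  (phi x - phi z) / (x - z) <= (phi y - phi x) / (y - x).
Proof.
move=> cphi zx xy.
have zy : 0 < y - z by rewrite subr_gt0 (lt_trans zx).
rewrite ler_pdivrMr ?subr_gt0 // mulrAC ler_pdivlMr ?subr_gt0 //.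
have t01 : 0 <= (y - x) / (y - z) <= 1.
  by apply/andP; split; [apply: divr_ge0; lra | rewrite ler_pdivrMr //; lra].
have := cphi _ z y t01.
have -> : (y - x) / (y - z) * z + (1 - (y - x) / (y - z)) * y = x.
  by field; rewrite gt_eqF.
move=> h; have := ler_wpM2l (ltW zy) h.
rewrite [X in _ <= X -> _](_ : _ = (y - x) * phi z + (x - z) * phi y).
  move=> h2; nra.
by field; rewrite gt_eqF.
Qed.

(** The equality case of Young's inequality. The witness is the slope of a supporting line at [x]:
    the supremum of the slopes of the chords ending at [x] from the left, that is, the left
    derivative. *)
Lemma conj_support k phi psi x : young_fun k phi -> conj_fun phi psi ->
  0 < x -> exists2 y, 0 <= y & psi y <= x * y - phi x.
Proof.
move=> yphi cpp x0.
pose S := [set (phi x - phi z) / (x - z) | z in [set z | z < x]].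
have ubS : ubound S (phi (x + 1) - phi x).
  move=> _ [z /= zx <-].
  have := @convex_fun_slope _ x (x + 1) z (young_convex yphi) zx.
  by rewrite addrAC subrr add0r divr1; apply; rewrite ltrDl.
have S0 : S ((phi x - phi 0) / (x - 0)) by exists 0.
have hS : has_sup S by split; [exists ((phi x - phi 0) / (x - 0)) | exists (phi (x + 1) - phi x)].
have inS s : S s -> s <= sup S by move=> Ss; apply: sup_upper_bound.
have y0 : 0 <= sup S.
  apply: le_trans (inS _ S0); rewrite (young_0 yphi) !subr0.
  by rewrite divr_ge0 ?(young_ge0 yphi) // ltW.
exists (sup S) => //; apply: (conj_sup cpp) => // z z0.
have [zx|xz|->] := ltgtP z x; last by [].
  have : (phi x - phi z) / (x - z) <= sup S by apply: inS; exists z.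
  by rewrite ler_pdivrMr ?subr_gt0 // => h; nra.
have : sup S <= (phi z - phi x) / (z - x).
  apply: sup_le_ub; first by exists ((phi x - phi 0) / (x - 0)).
  by move=> _ [w /= wx <-]; apply: convex_fun_slope => //; apply: young_convex yphi.
by rewrite ler_pdivlMr ?subr_gt0 // => h; nra.
Qed.

(** A variant of the classical [phi (psi y / y) <= psi y], with a gain of 2 that
    [orlicz_norm_modular] relies on. If [w] supports [phi] at [H], then [phi H <= H * w - psi w].
    When [2 * w <= y], the term [H * w] is at most [H * y / 2]; when [2 * w > y], doubling gives
    [psi w >= 2 * (H * w)] and the right-hand side is at most 0. *)
Lemma conj_quotient k phi psi y : young_fun k phi -> young_fun k psi ->
  conj_fun phi psi -> 0 < k -> 0 < y ->
  phi (psi y / (k * y)) <= psi y / (2 * k).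
Proof.
move=> yphi ypsi cpp k0 y0.
have p0 := young_ge0 ypsi y.
set H := psi y / (k * y).
have [H0|H0] := eqVneq H 0.
  by rewrite H0 (young_0 yphi) divr_ge0 // mulr_ge0 // ltW.
have Hpos : 0 < H by rewrite lt_def H0 divr_ge0 // mulr_ge0 // ltW.
have [w w0 hw] := conj_support yphi cpp Hpos.
have {hw} hw : phi H <= H * w - psi w by lra.
apply: le_trans hw _.
have HE : H * y = psi y / k.
  by rewrite /H; field; rewrite !gt_eqF.
have [wy|yw] := leP (2 * w) y.
  have h1 : H * (2 * w) <= H * y by rewrite ler_wpM2l // ltW.
  rewrite [leRHS](_ : _ = (psi y / k) / 2); last by field; rewrite gt_eqF.
  have := young_ge0 ypsi w; rewrite -HE; lra.
apply: (@le_trans _ _ 0); last by rewrite divr_ge0 // mulr_ge0 // ltW.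
rewrite subr_le0.
have t1 : 1 <= 2 * w / y by rewrite ler_pdivlMr // mul1r ltW.
have := young_dilate y ypsi t1; rewrite divfK ?gt_eqF // => h.
have {}h := le_trans h (young_double ypsi w0).
have : (2 * w / y * psi y) / k <= psi w by rewrite ler_pdivrMr // (mulrC (psi w)).
apply: le_trans; rewrite [leRHS](_ : _ = 2 * (H * w)).
  by rewrite ler_peMl ?ler1n // mulr_ge0 // ltW.
by rewrite /H; field; rewrite !gt_eqF.
Qed.

End FiniteYoung.

(** * Reduction of extended-valued Young functions to real-valued ones *)

Section FromErealYoung.
Context {R : realType}.
Implicit Types Phi Psi : R -> \bar R.
Local Open Scope ereal_scope.

Lemma young_functionZ Phi (t x : R) : young_function Phi -> (0 <= t <= 1)%R ->
  Phi (t * x)%R <= t%:E * Phi x.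
Proof.
move=> [_ P0 _ Pc _] t01; have := Pc t x 0%R t01.
by rewrite mulr0 addr0 P0 mule0 adde0.
Qed.

Lemma young_function_mono Phi (x y : R) : young_function Phi ->
  (0 <= x)%R -> (x <= y)%R -> Phi x <= Phi y.
Proof.
move=> yP x0 xy; have [P_ge0 P0 _ _ _] := yP.
have [x_eq0|x_neq0] := eqVneq x 0%R; first by rewrite x_eq0 P0.
have y0 : (0 < y)%R by apply: lt_le_trans xy; rewrite lt_def x_neq0.
have t01 : (0 <= x / y <= 1)%R.
  by rewrite divr_ge0 ?(ltW y0)//= ler_pdivrMr ?mul1r.
have := young_functionZ y yP t01; rewrite divfK ?gt_eqF // => /le_trans; apply.
by rewrite -[leRHS]mul1e lee_wpmul2r // lee_fin; case/andP: t01.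
Qed.

Lemma young_function_eventually Phi (c : R) : young_function Phi ->
  exists2 x : R, (0 < x)%R & c%:E <= Phi x.
Proof.
move=> [_ _ _ _ /cvgeyPge /(_ c) hP].
have [x x1 hx] := pinfty_ex_ge (num_real (1 : R)%R) hP.
by exists x => //; apply: lt_le_trans x1.
Qed.

(** [Phi] grows at least linearly: beyond a point [b] with [Phi b >= 1], convexity gives
    [Phi x >= x / b], so [x / b - Phi x] never exceeds 1. *)
Lemma conj_finite_near0 Phi Psi : complementary_pair Phi Psi ->
  exists2 a : R, (0 < a)%R & Psi a < +oo.
Proof.
move=> [yP _ PsiE]; have [P_ge0 P0 _ _ _] := yP.
have [b b0 hb] := young_function_eventually 1 yP.
exists b^-1%R; first by rewrite invr_gt0.
rewrite PsiE; apply: (@le_lt_trans _ _ 1); last exact: ltry.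
apply: ub_ereal_sup => _ [x /= x0 <-].
rewrite gtr0_norm ?invr_gt0 //.
have [xb|bx] := leP x b.
  apply: (@le_trans _ _ (x / b)%:E); last by rewrite lee_fin ler_pdivrMr // mul1r.
  by rewrite -[leRHS]sube0; apply: leeB.
have t01 : (0 <= b / x <= 1)%R.
  by rewrite divr_ge0 ?(ltW b0)//= ler_pdivrMr ?mul1r ?(ltW bx) // (lt_trans b0).
have := young_functionZ x yP t01; rewrite divfK ?gt_eqF ?(lt_trans b0) // => h.
have {h hb} := le_trans hb h.
case: (Phi x) (P_ge0 x) => [r||] //= _.
  rewrite -EFinM lee_fin mulrAC ler_pdivlMr ?(lt_trans b0) // mul1r => h.
  rewrite -EFinB lee_fin.
  have : (x / b <= r)%R by rewrite ler_pdivrMr // mulrC.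
  by lra.
by move=> _; rewrite addeNy leNye.
Qed.

(** Otherwise [Phi] is [+oo] at all positive numbers, so [Psi] is at most 0 everywhere and cannot
    tend to infinity. *)
Lemma finite_near0_complementary Phi Psi : complementary_pair Phi Psi ->
  exists2 a : R, (0 < a)%R & Phi a < +oo.
Proof.
move=> [[P_ge0 P0 _ _ _] yPsi PsiE]; apply: contrapT => nofin.
have Phiy (x : R) : (0 < x)%R -> Phi x = +oo.
  move=> x0; have [h|] := ltP (Phi x) +oo; first by case: nofin; exists x.
  by rewrite leye_eq => /eqP.
have [b b0] := young_function_eventually 1 yPsi.
rewrite PsiE leNgt => /negP; apply.
apply: (@le_lt_trans _ _ 0); last by rewrite lte_fin.
apply: ub_ereal_sup => _ [x /= x0 <-].
have [->|x_neq0] := eqVneq x 0%R; first by rewrite mul0r P0 sube0.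
by rewrite Phiy ?lt_def ?x_neq0 // addeNy leNye.
Qed.

(** Doubling alone does not exclude the function equal to [+oo] off 0. One finite value at some
    [a > 0] spreads to all [2 ^+ j * a], then everywhere by monotonicity and evenness. *)
Lemma double_finite Phi (a k : R) : young_function Phi -> (0 < a)%R ->
  Phi a < +oo -> (forall x : R, (0 <= x)%R -> Phi (2 * x)%R <= k%:E * Phi x) ->
  forall x, Phi x \is a fin_num.
Proof.
move=> yP a0 fa dP; have [P_ge0 P0 Pe _ _] := yP.
have fj j : Phi (2 ^+ j * a)%R < +oo.
  elim: j => [|j IH]; first by rewrite expr0 mul1r.
  rewrite exprS -mulrA; apply: le_lt_trans (dP _ _) _.
    by rewrite mulr_ge0 ?exprn_ge0 // ltW.
  by move: IH (P_ge0 (2 ^+ j * a)%R); case: (Phi _) => // r _ _; rewrite -EFinM ltry.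
have f0 x : (0 <= x)%R -> Phi x \is a fin_num.
  move=> x0; rewrite ge0_fin_numE //.
  apply: le_lt_trans (fj (Num.bound (x / a))).
  apply: young_function_mono => //; rewrite -ler_pdivrMr //; apply: ltW.
  apply: lt_trans (archi_boundP _) _; first by rewrite divr_ge0 // ltW.
  by rewrite -natrX ltr_nat ltn_expl.
by move=> x; have [/f0//|/ltW] := leP 0%R x; rewrite -oppr_ge0 -Pe => /f0.
Qed.

Lemma young_fun_fine Phi (k : R) : young_function Phi ->
  (forall x, Phi x \is a fin_num) ->
  (forall x : R, (0 <= x)%R -> Phi (2 * x)%R <= k%:E * Phi x) ->
  forall k', (k <= k')%R -> young_fun k' (fine \o Phi).
Proof.
move=> [P_ge0 P0 Pe Pc _] fP dP k' kk'; split => /=.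
- by move=> x; apply: fine_ge0.
- by rewrite P0.
- by move=> x; rewrite Pe.
- move=> t x y t01 /=; have := Pc t x y t01.
  by move=> h; rewrite -lee_fin EFinD !EFinM !fineK.
move=> x x0; apply: (@le_trans _ _ (k * fine (Phi x))%R).
  by rewrite -lee_fin EFinM !fineK // dP.
by rewrite ler_wpM2r // fine_ge0.
Qed.

(** Non-compactness sets the threshold in [delta2] to 0, so doubling is global; the common constant
    is the larger of the two. *)
Lemma young_pair_fine (T : topologicalType) Phi Psi : ~ compact [set: T] ->
  complementary_pair Phi Psi -> delta2 T Phi -> delta2 T Psi ->
  exists k : R, exists phi, exists psi, [/\ (0 < k)%R,
    Phi = EFin \o phi /\ Psi = EFin \o psi,
    young_fun k phi, young_fun k psi & conj_fun phi psi].
Proof.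
move=> ncT cPP [k1 [x1 [k10 _ /(_ ncT) -> d1]]] [k2 [x2 [k20 _ /(_ ncT) -> d2]]].
have [yPhi yPsi PsiE] := cPP.
have [a a0 fa] := finite_near0_complementary cPP.
have fPhi := double_finite yPhi a0 fa d1.
have [b b0 fb] := conj_finite_near0 cPP.
have fPsi := double_finite yPsi b0 fb d2.
exists (Num.max k1 k2), (fine \o Phi), (fine \o Psi); split.
- by rewrite lt_max k10.
- by split; apply/funext => x /=; rewrite fineK.
- by apply: young_fun_fine d1 _ _ => //; rewrite le_max lexx.
- by apply: young_fun_fine d2 _ _ => //; rewrite le_max lexx orbT.
split => [x y x0 y0|y c y0 h] /=.
  rewrite -lee_fin EFinD !fineK // -leeBlDl // PsiE.
  by apply: ereal_sup_ubound; exists x => //; rewrite ger0_norm.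
rewrite -lee_fin fineK // PsiE; apply: ub_ereal_sup => _ [x /= x0 <-].
by rewrite -[Phi x]fineK // -EFinB lee_fin ger0_norm // h.
Qed.

End FromErealYoung.

(** * Haar measure and averages over finite sets *)

Section Haar.
Context {R : realType} {G : topGroupType}.

Lemma mulgl_continuous (x : G) : continuous (fun y : G => (x * y)%g).
Proof.
move=> y; apply: (@continuous_comp _ _ _ (fun y : G => (x, y)) (fun z => (z.1 * z.2)%g)).
  by apply: cvg_pair; [exact: cvg_cst | exact: cvg_id].
exact: mulg_continuous.
Qed.

Lemma mulgr_continuous (x : G) : continuous (fun y : G => (y * x)%g).
Proof.
move=> y; apply: (@continuous_comp _ _ _ (fun y : G => (y, x)) (fun z => (z.1 * z.2)%g)).
  by apply: cvg_pair; [exact: cvg_id | exact: cvg_cst].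
exact: mulg_continuous.
Qed.

Lemma open_borel (U : set G) : open U -> measurable (U : set (borel G)).
Proof. exact: sub_gen_smallest. Qed.

Lemma compact_borel (K : set G) : hausdorff_space G -> compact K ->
  measurable (K : set (borel G)).
Proof.
move=> hG cK; rewrite -[K]setCK; apply: measurableC; apply: open_borel.
by rewrite openC; apply: compact_closed.
Qed.

Lemma continuous_borel (f : G -> G) : continuous f ->
  measurable_fun [set: borel G] (f : borel G -> borel G).
Proof.
move=> cf; apply: (@measurability _ _ (borel G) (borel G) setT f (@open G)) => //.
move=> _ [U oU <-]; rewrite setTI.
by apply: open_borel; apply: open_comp => // ? _; apply: cf.
Qed.

Lemma measurable_mulgl (x : G) :
  measurable_fun [set: borel G] (fun y : borel G => (x * y)%g : borel G).
Proof. by apply: continuous_borel; apply: mulgl_continuous. Qed.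

Lemma image_mulgl (x : G) (A : set G) :
  [set (x * y)%g | y in A] = (fun y => (x^-1 * y)%g) @^-1` A.
Proof.
apply/seteqP; split => [_ [y Ay <-]|y Ay] /=; first by rewrite mulKg.
by exists (x^-1 * y)%g => //; rewrite mulVKg.
Qed.

Variable mu : {measure set (borel G) -> \bar R}.
Hypothesis haar : left_haar mu.

Lemma haar_preimage (x : G) (A : set (borel G)) : measurable A ->
  mu ((fun y => (x * y)%g) @^-1` A) = mu A.
Proof.
by move=> mA; case: haar => _ _ _ _ /(_ x^-1%g A mA) <-; rewrite image_mulgl invgK.
Qed.

Lemma haar_integral (x : G) (f : borel G -> \bar R) :
  measurable_fun [set: borel G] f -> (forall y, (0 <= f y)%E) ->
  (\int[mu]_y f (x * y)%g = \int[mu]_y f y)%E.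
Proof.
move=> mf f0; have := @ge0_integral_pushforward _ _ (borel G) (borel G) R _
  (measurable_mulgl x) mu setT f measurableT mf (fun y _ => f0 y).
rewrite preimage_setT => <-.
apply: eq_measure_integral => [|? A mA _]; first exact: measurable_mulgl.
by rewrite -(haar_preimage x mA).
Qed.
End Haar.

(** * Integrals of nonnegative real functions *)

Section NonnegIntegral.
Context d (T : measurableType d) (R : realType) (mu : {measure set T -> \bar R}).
Implicit Types (f g : T -> R) (c : R).

Definition nonneg_mfun f := measurable_fun [set: T] f /\ forall x, 0 <= f x.

Definition nintegral f : \bar R := (\int[mu]_x (f x)%:E)%E.

Lemma nonneg_mfunD f g : nonneg_mfun f -> nonneg_mfun g ->
  nonneg_mfun (fun x => f x + g x).
Proof.
move=> [mf f0] [mg g0]; split; first exact: measurable_funD.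
by move=> x; rewrite addr_ge0.
Qed.

Lemma nonneg_mfunM f g : nonneg_mfun f -> nonneg_mfun g ->
  nonneg_mfun (fun x => f x * g x).
Proof.
move=> [mf f0] [mg g0]; split; first exact: measurable_funM.
by move=> x; rewrite mulr_ge0.
Qed.

Lemma nonneg_mfun_cst c : 0 <= c -> nonneg_mfun (fun=> c).
Proof. by move=> c0; split. Qed.

Lemma nonneg_mfunZ c f : 0 <= c -> nonneg_mfun f -> nonneg_mfun (fun x => c * f x).
Proof. by move=> c0; apply: nonneg_mfunM; exact: nonneg_mfun_cst. Qed.

Lemma nonneg_mfun_sum (I : Type) (s : seq I) (h : I -> T -> R) :
  (forall i, nonneg_mfun (h i)) -> nonneg_mfun (fun x => \sum_(i <- s) h i x).
Proof.
move=> nh; elim: s => [|i s IH].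
  under eq_fun do rewrite big_nil.
  exact: nonneg_mfun_cst.
under eq_fun do rewrite big_cons.
exact: nonneg_mfunD.
Qed.

Lemma nonneg_mfun_norm f : measurable_fun [set: T] f -> nonneg_mfun (fun x => `|f x|).
Proof. by move=> mf; split => //; apply: measurableT_comp => //; exact: normr_measurable. Qed.

Lemma nintegral_ge0 f : (forall x, 0 <= f x) -> (0 <= nintegral f)%E.
Proof. by move=> f0; apply: integral_ge0 => x _; rewrite lee_fin. Qed.

Lemma nintegral_le f g : nonneg_mfun f -> nonneg_mfun g ->
  (forall x, f x <= g x) -> (nintegral f <= nintegral g)%E.
Proof.
move=> [mf f0] [mg g0] fg; apply: ge0_le_integral => //.
- by move=> x _; rewrite lee_fin.
- exact/measurable_EFinP.
- exact/measurable_EFinP.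
- by move=> x _; rewrite lee_fin.
Qed.

Lemma nintegralD f g : nonneg_mfun f -> nonneg_mfun g ->
  (nintegral (fun x => f x + g x)%R = nintegral f + nintegral g)%E.
Proof.
move=> [mf f0] [mg g0]; rewrite /nintegral -ge0_integralD //.
- by move=> x _; rewrite lee_fin.
- exact/measurable_EFinP.
- by move=> x _; rewrite lee_fin.
- exact/measurable_EFinP.
Qed.

Lemma nintegralZ c f : 0 <= c -> nonneg_mfun f ->
  (nintegral (fun x => c * f x)%R = c%:E * nintegral f)%E.
Proof.
move=> c0 [mf f0]; rewrite /nintegral; under eq_integral do rewrite EFinM.
rewrite ge0_integralZl_EFin //; first by move=> x _; rewrite lee_fin.
exact/measurable_EFinP.
Qed.

Lemma nintegral_sum (I : Type) (s : seq I) (h : I -> T -> R) (c : \bar R) :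
  (forall i, nonneg_mfun (h i)) -> (forall i, nintegral (h i) = c) ->
  (nintegral (fun x => \sum_(i <- s) h i x)%R = (size s)%:R%:E * c)%E.
Proof.
move=> nh hc; elim: s => [|i s IH].
  rewrite mul0e /nintegral; under eq_integral do rewrite big_nil.
  by rewrite integral0.
rewrite /nintegral; under eq_integral do rewrite big_cons.
rewrite -/(nintegral _) nintegralD ?IH ?hc //; last exact: nonneg_mfun_sum.
have c0 : (0 <= c)%E by rewrite -(hc i); apply: nintegral_ge0; case: (nh i).
by rewrite -[X in (X + _)%E]mul1e -ge0_muleDl ?lee_fin // -EFinD -natr1 addrC.
Qed.

End NonnegIntegral.

Section Averages.
Context {R : realType} {G : topGroupType}.
Implicit Types (v : borel G -> R) (s t : seq G).

(** Convolution of [v] by the uniform probability on the entries of [s], counted with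
    multiplicity. *)
Definition avg s v (y : G) : R :=
  (size s)%:R^-1 * \sum_(x <- s) v (x^-1 * y)%g.

Lemma mfun_translate v (x : G) : measurable_fun [set: borel G] v ->
  measurable_fun [set: borel G] (fun y : borel G => v (x * y)%g).
Proof.
by move=> mv; apply: measurableT_comp mv _; exact: measurable_mulgl.
Qed.

Lemma nonneg_mfun_translate v (x : G) : nonneg_mfun v ->
  nonneg_mfun (fun y : borel G => v (x * y)%g).
Proof. by move=> [mv v0]; split => //; exact: mfun_translate. Qed.

Lemma nonneg_mfun_avg s v : nonneg_mfun v -> nonneg_mfun (avg s v : borel G -> R).
Proof.
move=> nv; apply: nonneg_mfunZ; first by rewrite invr_ge0.
by apply: nonneg_mfun_sum => x; exact: nonneg_mfun_translate.
Qed.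

(** The form of Reiter's L^1 condition for finite sets of translations; finiteness lets its failure
    produce a finitely supported measure. *)
Definition reiter (mu : {measure set (borel G) -> \bar R}) :=
  forall s (e : R), 0 < e -> exists w : borel G -> R,
    [/\ nonneg_mfun w, nintegral mu w = 1%E &
      forall x, x \in s ->
        (nintegral mu (fun y => `|w (x^-1 * y)%g - w y|)%R <= e%:E)%E].

Variable mu : {measure set (borel G) -> \bar R}.
Hypothesis haar : left_haar mu.

Lemma nintegral_translate v (x : G) : nonneg_mfun v ->
  nintegral mu (fun y => v (x * y)%g) = nintegral mu v.
Proof.
move=> [mv v0]; apply: (haar_integral haar x (f := fun y => (v y)%:E)).
  exact/measurable_EFinP.
by move=> y; rewrite lee_fin.
Qed.

Lemma nintegral_avg s v : s != [::] -> nonneg_mfun v ->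
  nintegral mu (avg s v) = nintegral mu v.
Proof.
move=> s0 nv; rewrite [LHS]nintegralZ ?invr_ge0 //; last first.
  by apply: nonneg_mfun_sum => x; exact: nonneg_mfun_translate.
rewrite (@nintegral_sum _ _ _ _ _ _ _ (nintegral mu v)).
- rewrite muleA -EFinM mulVf ?mul1e // pnatr_eq0.
  by rewrite size_eq0.
- by move=> x; exact: nonneg_mfun_translate.
- by move=> x; exact: nintegral_translate.
Qed.

(** The difference between the mean of the squares and the square of the mean is the variance, and
    the terms of [i] and [j] alone contribute [(a i - m) ^+ 2 + (a j - m) ^+ 2 >= (a i - a j) ^+ 2 /
    2]. *)
Lemma avg_sqr_gap (I : eqType) (a : I -> R) (i j : I) (s : seq I) : j \in s ->
  let n := (size (i :: s))%:R in
  (n^-1 * \sum_(k <- i :: s) a k) ^+ 2 + (2 * n)^-1 * (a i - a j) ^+ 2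
    <= n^-1 * \sum_(k <- i :: s) a k ^+ 2.
Proof.
move=> js; set n := (X in let n := X in _); rewrite /=; set m := n^-1 * _.
have n0 : 0 < n by rewrite ltr0n.
have mE : n * m = \sum_(k <- i :: s) a k by rewrite mulVKf ?gt_eqF.
have var : \sum_(k <- i :: s) (a k - m) ^+ 2 =
    \sum_(k <- i :: s) a k ^+ 2 - n * m ^+ 2.
  rewrite (eq_bigr (fun k => a k ^+ 2 + (- (2 * m) * a k + m ^+ 2))); last first.
    by move=> k _; ring.
  rewrite big_split big_split /= -mulr_sumr -mE big_const_seq count_predT.
  by rewrite iter_addr addr0 -mulr_natl -/n; ring.
have : (a i - a j) ^+ 2 / 2 <= \sum_(k <- i :: s) (a k - m) ^+ 2.
  rewrite big_cons (big_rem j) //=.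
  have : 0 <= \sum_(k <- rem j s) (a k - m) ^+ 2.
    by apply: sumr_ge0 => k _; exact: sqr_ge0.
  set S := \sum_(k <- _) _ => S0.
  have : 0 <= ((a i - m) + (a j - m)) ^+ 2 by exact: sqr_ge0.
  rewrite !expr2; nra.
rewrite var => h.
rewrite ler_pdivlMl // mulrDr -lerBrDl.
apply: le_trans h; rewrite le_eqVlt; apply/orP; left; apply/eqP.
by field; rewrite gt_eqF.
Qed.

End Averages.

(** * Failure of Reiter's condition and contraction on L^2 *)

Section Contraction.
Context {R : realType} {G : topGroupType}.
Variable mu : {measure set (borel G) -> \bar R}.
Hypothesis haar : left_haar mu.
Implicit Types (v f g : borel G -> R) (s t : seq G).

(** Transfers a displacement of the density [v ^+ 2 / A] in L^1 to one of [v] in L^2. The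
    factorization of a difference of squares is followed by a weighted mean inequality in place of
    Cauchy-Schwarz; the weights make the second term integrate to exactly [e / 2]. *)
Lemma sqr_dist_lower v (x : G) (e A : R) : nonneg_mfun v -> 0 < e -> 0 < A ->
  nintegral mu (fun y => v y ^+ 2) = A%:E ->
  (e%:E < nintegral mu (fun y =>
     `|v (x^-1 * y)%g ^+ 2 / A - v y ^+ 2 / A|)%R)%E ->
  ((e ^+ 2 * A / 4)%:E <= nintegral mu (fun y => (v y - v (x^-1 * y)%g) ^+ 2)%R)%E.
Proof.
move=> nv e0 A0 vA.
have [mv v0] := nv.
have nv2 : nonneg_mfun (fun y => v y ^+ 2).
  by under eq_fun do rewrite expr2; apply: nonneg_mfunM.
set D := nintegral mu (fun y => (v y - _) ^+ 2).
have nd : nonneg_mfun (fun y : borel G => (v y - v (x^-1 * y)%g) ^+ 2).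
  split => [|y]; last exact: sqr_ge0.
  apply: measurable_funX; apply: measurable_funB => //.
  exact: mfun_translate.
have D0 : (0 <= D)%E by apply: nintegral_ge0; case: nd.
have ntv2 : nonneg_mfun (fun y : borel G => v (x^-1 * y)%g ^+ 2).
  exact: (nonneg_mfun_translate x^-1%g nv2).
have c1 : 0 <= 2 / (e * A) by rewrite divr_ge0 // mulr_ge0 // ltW.
have c2 : 0 <= e / (4 * A) by rewrite divr_ge0 // ?mulr_ge0 // ltW.
have hle : (nintegral mu (fun y => `|v (x^-1 * y)%g ^+ 2 / A - v y ^+ 2 / A|)%R
    <= (2 / (e * A))%:E * D + (e / 2)%:E)%E.
  apply: (@le_trans _ _ (nintegral mu (fun y =>
     (2 / (e * A)) * (v y - v (x^-1 * y)%g) ^+ 2 +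
     (e / (4 * A)) * (v (x^-1 * y)%g ^+ 2 + v y ^+ 2))%R)).
    apply: nintegral_le.
    - split => // ; apply: measurableT_comp; first exact: normr_measurable.
      apply: measurable_funB; apply: measurable_funM => //.
        by case: ntv2.
      by case: nv2.
    - apply: nonneg_mfunD; apply: nonneg_mfunZ => //.
      exact: nonneg_mfunD.
    move=> y; set a := v (_ * _)%g; set b := v y.
    have a0 : 0 <= a by exact: v0.
    have b0 : 0 <= b by exact: v0.
    rewrite -mulrBl normrM (gtr0_norm (_ : 0 < A^-1)) ?invr_gt0 //.
    rewrite ler_pdivrMr // mulrDl.
    rewrite [leRHS](_ : _ = 2 / e * (b - a) ^+ 2 + e / 4 * (a ^+ 2 + b ^+ 2)); last first.
      by field; rewrite !gt_eqF.
    rewrite subr_sqr normrM (ger0_norm (_ : 0 <= a + b)) ?addr_ge0 //.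
    have -> : (b - a) ^+ 2 = `|a - b| ^+ 2 by rewrite real_normK ?num_real //; ring.
    set z := `|a - b|.
    (* This sum of squares is exactly the difference of the two sides. *)
    have : 0 <= e / 8 * (a + b - 4 / e * z) ^+ 2 + e / 8 * (a - b) ^+ 2.
      by rewrite addr_ge0 // mulr_ge0 ?sqr_ge0 // divr_ge0 // ltW.
    rewrite -subr_ge0 => h; rewrite -subr_ge0.
    apply: le_trans h _; rewrite le_eqVlt; apply/orP; left; apply/eqP.
    by field; rewrite gt_eqF.
  have nsum := nonneg_mfunD ntv2 nv2.
  rewrite nintegralD ?nintegralZ ?nintegralD //; try exact: nonneg_mfunZ.
  rewrite (nintegral_translate haar x^-1%g nv2) vA -EFinD -EFinM leeD2l // lee_fin.
  by rewrite le_eqVlt; apply/orP; left; apply/eqP; field; rewrite gt_eqF.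
move=> /lt_le_trans /(_ hle) {hle}.
case: D D0 => [D|_ _|//]; last by rewrite leey.
rewrite !lee_fin lte_fin => D0 h.
have : e / 2 < 2 / (e * A) * D by lra.
rewrite mulrAC ltr_pdivlMr ?mulr_gt0 // => h2.
by apply: ltW; rewrite expr2; nra.
Qed.

(** If Reiter's condition fails for [s] and [e], no density is [e]-invariant under all of [s].
    Applied to [v ^+ 2 / A], this gives an element of [s] that moves [v] in L^2, and [avg_sqr_gap]
    at that element and the identity yields the loss. *)
Lemma not_reiter_contract : ~ reiter mu -> exists s, exists r : R,
  [/\ s != [::], 0 <= r < 1 & forall v, nonneg_mfun v ->
    (nintegral mu (fun y => v y ^+ 2)%R < +oo ->
    nintegral mu (fun y => avg s v y ^+ 2)%R <=
    r%:E * nintegral mu (fun y => v y ^+ 2)%R)%E].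
Proof.
move=> /existsNP[s /existsNP[e /not_implyP[e0 nw]]].
(* The first identity makes [v] itself one of the averaged translates; the second keeps the tail
   nonempty, which serves the case where [v] has norm 0. *)
pose n : R := (size (1%g :: 1%g :: s))%:R.
have n0 : 0 < n by rewrite ltr0n.
(* The loss is [(2 * n)^-1] from [avg_sqr_gap] times [e ^+ 2 * A / 4] from [sqr_dist_lower]; the
   maximum with 0 secures [0 <= r]. *)
exists (1%g :: 1%g :: s), (Num.max (1 - e ^+ 2 / (8 * n)) 0); split => //.
  rewrite le_max lexx orbT /= gt_max ltr01 andbT ltrBlDr ltrDl.
  by rewrite divr_gt0 ?exprn_gt0 // mulr_gt0.
move=> v nv fin; have [mv v0] := nv.
have nv2 : nonneg_mfun (fun y => v y ^+ 2).
  by under eq_fun do rewrite expr2; apply: nonneg_mfunM.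
have navg2 (t : seq G) : nonneg_mfun (fun y : borel G => avg t v y ^+ 2).
  by under eq_fun do rewrite expr2; apply: nonneg_mfunM; exact: nonneg_mfun_avg.
have nd x : nonneg_mfun (fun y : borel G => (v y - v (x^-1 * y)%g) ^+ 2).
  split => [|y]; last exact: sqr_ge0.
  apply: measurable_funX; apply: measurable_funB => //.
  exact: mfun_translate.
have jensen j : j \in 1%g :: s ->
  (nintegral mu (fun y => avg (1%g :: 1%g :: s) v y ^+ 2)%R + (2 * n)^-1%:E *
    nintegral mu (fun y => (v y - v (j^-1 * y)%g) ^+ 2)%R <=
    nintegral mu (fun y => v y ^+ 2)%R)%E.
  move=> js; rewrite -nintegralZ ?invr_ge0 ?mulr_ge0 ?(ltW n0) // -nintegralD //; last first.
    by apply: nonneg_mfunZ => //; rewrite invr_ge0 mulr_ge0 ?(ltW n0).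
  rewrite -(nintegral_avg haar (s := 1%g :: 1%g :: s) _ nv2) //; apply: nintegral_le.
  - apply: nonneg_mfunD => //; apply: nonneg_mfunZ => //.
    by rewrite invr_ge0 mulr_ge0 ?(ltW n0).
  - exact: nonneg_mfun_avg.
  move=> y.
  have := @avg_sqr_gap R _ (fun k => v (k^-1 * y)%g) 1%g j (1%g :: s) js.
  by rewrite /= invg1 mul1g.
have [A A0 vA] : exists2 A : R, 0 <= A & nintegral mu (fun y => v y ^+ 2) = A%:E.
  have h0 : (0 <= nintegral mu (fun y => v y ^+ 2)%R)%E.
    by apply: nintegral_ge0; case: nv2.
  case: nintegral h0 fin => // A h _; exists A => //.
have [A_eq0|A_neq0] := eqVneq A 0.
  rewrite vA A_eq0 mule0.
  have := jensen 1%g (mem_head _ _); rewrite vA A_eq0; apply: le_trans.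
  by rewrite leeDl // mule_ge0 ?lee_fin ?invr_ge0 ?mulr_ge0 ?(ltW n0) // nintegral_ge0 //; case: (nd 1%g).
have Apos : 0 < A by rewrite lt_def A_neq0.
have [j js hj] : exists2 j, j \in s & (e%:E < nintegral mu (fun y =>
     `|v (j^-1 * y)%g ^+ 2 / A - v y ^+ 2 / A|)%R)%E.
  apply: contrapT => hn; apply: nw; exists (fun y => v y ^+ 2 / A); split.
  - by under eq_fun do rewrite mulrC; apply: nonneg_mfunZ => //; rewrite invr_ge0.
  - under eq_fun do rewrite mulrC.
    by rewrite nintegralZ ?invr_ge0 // vA -EFinM mulVf.
  by move=> x xs; rewrite leNgt; apply/negP => h; apply: hn; exists x.
have hD := sqr_dist_lower nv e0 Apos vA hj.
have := jensen j; rewrite inE js orbT vA => /(_ isT) hJ.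
have {}hJ : (nintegral mu (fun y => avg (1%g :: 1%g :: s) v y ^+ 2)%R +
  (2 * n)^-1%:E * (e ^+ 2 * A / 4)%:E <= A%:E)%E.
  apply: le_trans hJ; rewrite leeD2l // lee_wpmul2l // lee_fin.
  by rewrite invr_ge0 mulr_ge0 ?(ltW n0).
apply: (@le_trans _ _ ((1 - e ^+ 2 / (8 * n)) * A)%:E); last first.
  by rewrite -EFinM lee_fin ler_wpM2r // le_max lexx.
move: hJ; rewrite -EFinM -leeBrDr // => /le_trans; apply.
rewrite -EFinB lee_fin le_eqVlt; apply/orP; left; apply/eqP.
by field; rewrite gt_eqF.
Qed.

End Contraction.

(** * Powers of an average and decay of Orlicz pairings *)

Section Powers.
Context {R : realType} {G : topGroupType}.
Implicit Types (v f g : borel G -> R) (s t : seq G).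

(** Repeated products are kept, so that the uniform average over this list is the [n]-th power of
    the average over [s]. *)
Definition pow_seq s n : seq G :=
  iter n (fun t => [seq (x * y)%g | x <- s, y <- t]) [:: 1%g].

Lemma pow_seq_neq0 s n : s != [::] -> pow_seq s n != [::].
Proof.
move=> s0; elim: n => // n IH /=.
by rewrite -size_eq0 size_allpairs muln_eq0 !size_eq0 negb_or s0.
Qed.

Lemma avg1 v : avg [:: 1%g] v = v.
Proof. by apply/funext => y; rewrite /avg big_seq1 invg1 mul1g invr1 mul1r. Qed.

Lemma avg_prod s t v :
  avg [seq (x * y)%g | x <- s, y <- t] v = avg s (avg t v).
Proof.
apply/funext => y; rewrite /avg size_allpairs natrM invfM -mulrA; congr (_ * _).
rewrite big_allpairs_dep /= mulr_sumr; apply: eq_bigr => x _; congr (_ * _).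
by apply: eq_bigr => z _; rewrite invgM mulgA.
Qed.

Variable mu : {measure set (borel G) -> \bar R}.
Hypothesis haar : left_haar mu.

Lemma contract_pow s (r : R) : 0 <= r ->
  (forall v, nonneg_mfun v ->
    (nintegral mu (fun y => v y ^+ 2)%R < +oo ->
    nintegral mu (fun y => avg s v y ^+ 2)%R <=
    r%:E * nintegral mu (fun y => v y ^+ 2)%R)%E) ->
  forall n v, nonneg_mfun v ->
    (nintegral mu (fun y => v y ^+ 2)%R < +oo ->
    nintegral mu (fun y => avg (pow_seq s n) v y ^+ 2)%R <=
    (r ^+ n)%:E * nintegral mu (fun y => v y ^+ 2)%R)%E.
Proof.
move=> r0 H n v nv fin; elim: n => [|n IH]; first by rewrite avg1 expr0 mul1e.
rewrite /= avg_prod exprS EFinM -muleA.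
apply: le_trans (lee_wpmul2l _ IH) => //.
apply: H; first exact: nonneg_mfun_avg.
apply: le_lt_trans IH _; apply: lte_mul_pinfty; rewrite ?lee_fin ?exprn_ge0 //.
Qed.

Lemma nonneg_mfun_young k (phi : R -> R) f : young_fun k phi ->
  nonneg_mfun f -> nonneg_mfun (fun x => phi (f x)).
Proof.
move=> yphi [mf f0]; split => [|x]; last exact: young_ge0 yphi _.
(* [phi] is nondecreasing only on the half-line; after the positive part it is nondecreasing on all
   reals, hence Borel. *)
rewrite (_ : (fun _ => _) = (fun z => phi (Num.max z 0)) \o f); last first.
  by apply/funext => x /=; rewrite max_l.
apply: measurableT_comp mf; apply: nondecreasing_measurable => // x y xy.
apply: (young_mono yphi); first by rewrite le_max lexx orbT.
by rewrite ge_max !le_max lexx orbT xy.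
Qed.

Lemma nonneg_mfun_sqrt f : nonneg_mfun f -> nonneg_mfun (fun x => Num.sqrt (f x)).
Proof.
move=> [mf _]; split => [|x]; last exact: sqrtr_ge0.
rewrite (_ : (fun _ => _) = Num.sqrt \o f) //; apply: measurableT_comp mf.
by apply: nondecreasing_measurable => // x y xy; exact: ler_wsqrtr.
Qed.

(** The hypothesis is applied to [f y] and each translate of [v], then averaged; the factors
    depending on [f y] alone come out of the sum. *)
Lemma le_mul_avg s (phi psi : R -> R) (a K : R) f v :
  s != [::] ->
  (forall x y, 0 <= x -> 0 <= y ->
    x * y <= a * (phi x + psi y) + K * (Num.sqrt (phi x) * Num.sqrt (psi y))) ->
  (forall x, 0 <= f x) -> (forall x, 0 <= v x) -> forall y,
  f y * avg s v y <= a * phi (f y) + a * avg s (psi \o v) y +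
    K * (Num.sqrt (phi (f y)) * avg s (fun z => Num.sqrt (psi (v z))) y).
Proof.
move=> s0 hK f0 v0 y; rewrite /avg.
have n0 : 0 < (size s)%:R :> R by rewrite ltr0n lt0n size_eq0.
rewrite -(ler_pM2l n0).
have -> (b c : R) : (size s)%:R * (b * ((size s)%:R^-1 * c)) = b * c.
  by field; rewrite gt_eqF.
rewrite !mulrDr.
have -> (b c : R) : (size s)%:R * (b * ((size s)%:R^-1 * c)) = b * c.
  by field; rewrite gt_eqF.
have -> (b c d : R) : (size s)%:R * (b * (d * ((size s)%:R^-1 * c))) = b * (d * c).
  by field; rewrite gt_eqF.
rewrite !mulr_sumr.
have -> : (size s)%:R * (a * phi (f y)) = \sum_(x <- s) a * phi (f y).
  by rewrite big_const_seq count_predT iter_addr addr0 mulr_natl.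
rewrite -!big_split /=; apply: ler_sum => x _.
by rewrite -mulrDr; exact: hK.
Qed.

(** The [a]-terms integrate to at most [a * (1 + M)], since averaging preserves the integral of
    [psi (g y)]. The mixed term is a product of two L^2 functions, [sqrt (phi f)] and the average of
    [sqrt (psi g)]; the second has squared norm at most [r ^+ n * M]. The power [n] depends on the
    bounds only, hence is uniform in [f] and [g]. *)
Lemma young_avg_small k (phi psi : R -> R) s (r M c : R) :
  young_fun k phi -> young_fun k psi -> conj_fun phi psi -> 0 < k ->
  s != [::] -> 0 <= r < 1 -> 0 <= M -> 0 < c ->
  (forall v, nonneg_mfun v ->
    (nintegral mu (fun y => v y ^+ 2)%R < +oo ->
    nintegral mu (fun y => avg s v y ^+ 2)%R <=
    r%:E * nintegral mu (fun y => v y ^+ 2)%R)%E) ->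
  exists n, forall f g, nonneg_mfun f -> nonneg_mfun g ->
    (nintegral mu (fun y => phi (f y)) <= 1 ->
     nintegral mu (fun y => psi (g y)) <= M%:E ->
     nintegral mu (fun y => f y * avg (pow_seq s n) g y)%R <= c%:E)%E.
Proof.
move=> yphi ypsi cpp k0 s0 /andP[r0 r1] M0 c0 hr.
(* The budget [c] is cut into quarters: [a * (1 + M)] is one, and [b] below is another. *)
pose a := c / (4 * (1 + M)).
have M1 : 0 < 1 + M by rewrite ltr_pwDl.
have a0 : 0 < a by rewrite divr_gt0 // mulr_gt0.
have [K K0 hK] := young_sqrt yphi ypsi cpp k0 a0.
pose b := c / 4.
have b0 : 0 < b by rewrite divr_gt0.
have [n hn] : exists n, K ^+ 2 / b * (r ^+ n * M) <= b.
  pose q := b / (K ^+ 2 / b * M + 1).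
  have q0 : 0 < q.
    by rewrite divr_gt0 // ltr_wpDl // mulr_ge0 // divr_ge0 ?sqr_ge0 // ltW.
  have [n hn] : exists n, r ^+ n < q.
    have /cvgrPdist_lt /(_ q q0) [n _ h] : r ^+ n @[n --> \oo] --> (0 : R).
      by apply: cvg_expr; rewrite ger0_norm.
    exists n; have := h n (leqnn n).
    by rewrite sub0r normrN ger0_norm // exprn_ge0.
  exists n; rewrite mulrCA mulrC; set L := K ^+ 2 / b * M.
  have L0 : 0 <= L by rewrite mulr_ge0 // divr_ge0 ?sqr_ge0 // ltW.
  apply: (@le_trans _ _ (L * q)); first by rewrite ler_wpM2l // ltW.
  have : (L + 1) * q = b by rewrite /q -/L mulrC divfK // gt_eqF // ltr_wpDl.
  by nra.
exists n => f g nf ng hf hg.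
have [mf f0] := nf; have [mg g0] := ng.
set t := pow_seq s n.
have t0 : t != [::] by exact: pow_seq_neq0.
have nphi := nonneg_mfun_young yphi nf.
have npsi := nonneg_mfun_young ypsi ng.
have nu := nonneg_mfun_sqrt nphi.
have nw := nonneg_mfun_sqrt npsi.
have sqrtE (h : borel G -> R) : (forall y, 0 <= h y) ->
    (fun y => Num.sqrt (h y) ^+ 2) = h.
  by move=> h0; apply/funext => y; rewrite sqr_sqrtr.
have nsq (h : borel G -> R) : nonneg_mfun h -> nonneg_mfun (fun y => h y ^+ 2).
  by move=> nh; under eq_fun do rewrite expr2; exact: nonneg_mfunM.
have hw : (nintegral mu (fun y => avg t (fun z => Num.sqrt (psi (g z))) y ^+ 2)%R
    <= (r ^+ n * M)%:E)%E.
  apply: le_trans (contract_pow r0 hr n nw _) _.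
    by rewrite sqrtE; [exact: le_lt_trans hg (ltry _) | case: npsi].
  rewrite sqrtE; last by case: npsi.
  by rewrite EFinM lee_wpmul2l // lee_fin exprn_ge0.
have npsia : nonneg_mfun (avg t (psi \o g) : borel G -> R) by exact: nonneg_mfun_avg.
have nwa : nonneg_mfun (avg t (fun z => Num.sqrt (psi (g z))) : borel G -> R).
  exact: nonneg_mfun_avg.
have Kb0 : 0 <= K ^+ 2 / b by rewrite divr_ge0 ?sqr_ge0 // ltW.
apply: (@le_trans _ _ (nintegral mu (fun y =>
   (a + b) * phi (f y) + (a * avg t (psi \o g) y +
   K ^+ 2 / b * avg t (fun z => Num.sqrt (psi (g z))) y ^+ 2)))).
  apply: nintegral_le.
  - by apply: nonneg_mfunM => //; exact: nonneg_mfun_avg.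
  - apply: nonneg_mfunD; first by apply: nonneg_mfunZ => //; rewrite addr_ge0 // ltW.
    apply: nonneg_mfunD; first by apply: nonneg_mfunZ => //; rewrite ltW.
    by apply: nonneg_mfunZ => //; exact: nsq.
  move=> y; apply: le_trans (le_mul_avg t0 hK f0 g0 y) _.
  rewrite mulrDl -!addrA lerD2l [leRHS]addrCA lerD2l.
  set u := Num.sqrt _; set w := avg _ _ _.
  have -> : phi (f y) = u ^+ 2 by rewrite sqr_sqrtr //; case: nphi.
  (* This is [b * u ^+ 2 + K ^+ 2 / b * w ^+ 2 - K * (u * w)] with the square completed. *)
  have : 0 <= b * (u - K / (2 * b) * w) ^+ 2 + 3 / 4 * (K ^+ 2 / b) * w ^+ 2.
    apply: addr_ge0; apply: mulr_ge0; rewrite ?sqr_ge0 ?(ltW b0) //.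
    by apply: mulr_ge0.
  move=> h; rewrite -subr_ge0; apply: le_trans h _.
  by rewrite le_eqVlt; apply/orP; left; apply/eqP; field; rewrite gt_eqF.
have nf1 : nonneg_mfun (fun y => (a + b) * phi (f y)).
  by apply: nonneg_mfunZ => //; rewrite addr_ge0 // ltW.
have nf2 : nonneg_mfun (fun y : borel G => a * avg t (psi \o g) y).
  by apply: nonneg_mfunZ => //; rewrite ltW.
have nf3 : nonneg_mfun (fun y : borel G => K ^+ 2 / b *
    avg t (fun z => Num.sqrt (psi (g z))) y ^+ 2).
  by apply: nonneg_mfunZ => //; exact: nsq.
have nf23 := nonneg_mfunD nf2 nf3.
have nwa2 := nsq _ nwa.
have ab0 : 0 <= a + b by rewrite addr_ge0 // ltW.
rewrite nintegralD // nintegralD // (nintegralZ mu ab0 nphi).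
rewrite (nintegralZ mu (ltW a0) npsia) (nintegralZ mu Kb0 nwa2).
rewrite (nintegral_avg haar t0 npsi).
apply: (@le_trans _ _ ((a + b) * 1 + (a * M + K ^+ 2 / b * (r ^+ n * M)))%:E).
  rewrite !EFinD [(_ * 1)%:E]EFinM [(a * M)%:E]EFinM [(_ * (_ * M))%:E]EFinM.
  apply: leeD; first by rewrite lee_wpmul2l // lee_fin addr_ge0 // ltW.
  apply: leeD; first by rewrite lee_wpmul2l // lee_fin ltW.
  by rewrite lee_wpmul2l // lee_fin.
rewrite lee_fin.
have -> : c = (a * (1 + M)) + b + 2 * b by rewrite /a /b; field; rewrite gt_eqF.
nra.
Qed.

End Powers.

Local Open Scope complex_scope.

(** * Orlicz spaces *)

Section ComplexModulus.
Context {R : realType}.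
Implicit Types z : R[i].

Lemma normc_ge0 z : 0 <= Normc.normc z.
Proof. by case: z => a b; exact: sqrtr_ge0. Qed.

Lemma normr_Re_le z : `|complex.Re z| <= Normc.normc z.
Proof.
by case: z => a b /=; rewrite -sqrtr_sqr ler_wsqrtr // lerDl sqr_ge0.
Qed.

Lemma normr_Im_le z : `|complex.Im z| <= Normc.normc z.
Proof.
by case: z => a b /=; rewrite -sqrtr_sqr ler_wsqrtr // lerDr sqr_ge0.
Qed.

Lemma normc_real (x : R) : Normc.normc x%:C = `|x|.
Proof. by rewrite /= expr0n /= addr0 sqrtr_sqr. Qed.

Lemma normc_le_ReIm z : Normc.normc z <= `|complex.Re z| + `|complex.Im z|.
Proof.
case: z => a b /=; rewrite -(@ler_pXn2r _ 2) ?nnegrE ?addr_ge0 ?sqrtr_ge0 //.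
rewrite sqr_sqrtr ?addr_ge0 ?sqr_ge0 // sqrrD !real_normK ?num_real //.
by rewrite lerD2r lerDl mulrn_wge0 // mulr_ge0.
Qed.

End ComplexModulus.

Section Orlicz.
Context {R : realType} {G : topGroupType}.
Variable mu : {measure set (borel G) -> \bar R}.
Hypothesis haar : left_haar mu.
Variables (k : R) (phi psi : R -> R).
Hypothesis (yphi : young_fun k phi) (ypsi : young_fun k psi).
Hypothesis (cpp : conj_fun phi psi) (k_gt0 : 0 < k).
Implicit Types (f g : G -> R[i]) (h : borel G -> R).

Notation LPhi := (orlicz_space mu (EFin \o phi)).
Notation LPsi := (orlicz_space mu (EFin \o psi)).
Notation normPhi := (luxemburg_norm mu (EFin \o phi)).
Notation normPsi := (orlicz_norm mu (EFin \o phi)).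

Lemma nonneg_mfun_modulus f : complex_measurable f ->
  nonneg_mfun (modulus f : borel G -> R).
Proof.
move=> [mr mi]; have nsum : nonneg_mfun (fun x : borel G =>
    complex.Re (f x) ^+ 2 + complex.Im (f x) ^+ 2).
  by apply: nonneg_mfunD; split => [|x]; rewrite ?sqr_ge0 //; exact: measurable_funX.
rewrite (_ : modulus f = fun x => Num.sqrt (complex.Re (f x) ^+ 2 + complex.Im (f x) ^+ 2)).
  exact: nonneg_mfun_sqrt.
by apply/funext => x; rewrite /modulus; case: (f x).
Qed.

Lemma complex_measurable_real h : measurable_fun [set: borel G] h ->
  complex_measurable (fun x => (h x)%:C).
Proof. by move=> mh; split. Qed.

Lemma complex_measurable_translate f (x : G) : complex_measurable f ->
  complex_measurable (fun y => f (x * y)%g).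
Proof.
move=> [mr mi]; split.
  exact: (@mfun_translate _ _ (fun y => complex.Re (f y))).
exact: (@mfun_translate _ _ (fun y => complex.Im (f y))).
Qed.

(** Membership in the space gives finiteness at one scale [a] only. Doubling [j] times with
    [2 ^+ j * a >= 1] reaches scale 1 at the cost of the factor [k ^+ j]. *)
Lemma modular_finite (p : R -> R) f : young_fun k p ->
  orlicz_space mu (EFin \o p) f ->
  (nintegral mu (fun x => p (modulus f x)) < +oo)%E.
Proof.
move=> yp [mf [a a0 fin]].
have nf := nonneg_mfun_modulus mf; have [_ f0] := nf.
have nfa : nonneg_mfun (fun x : borel G => p (a * modulus f x)).
  by apply: (nonneg_mfun_young yp); apply: nonneg_mfunZ => //; exact: ltW.
have [j hj] : exists j, 1 <= 2 ^+ j * a.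
  exists (Num.bound a^-1); rewrite -ler_pdivrMr // mul1r; apply: ltW.
  apply: lt_trans (archi_boundP _) _; first by rewrite invr_ge0 ltW.
  by rewrite -natrX ltr_nat ltn_expl.
apply: (@le_lt_trans _ _ (nintegral mu (fun x => k ^+ j * p (a * modulus f x)))).
  apply: nintegral_le.
  - exact: nonneg_mfun_young yp _.
  - by apply: nonneg_mfunZ => //; rewrite exprn_ge0 // ltW.
  move=> x; have a1 : 0 <= a * modulus f x by rewrite mulr_ge0 // ltW.
  apply: le_trans (young_pow2 j yp (ltW k_gt0) a1).
  by apply: (young_mono yp) => //; rewrite mulrA ler_peMl.
rewrite nintegralZ ?exprn_ge0 ?(ltW k_gt0) //.
apply: lte_mul_pinfty => //; first by rewrite lee_fin exprn_ge0 // ltW.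
Qed.

Lemma orlicz_space_bounded_modular (p : R -> R) f : complex_measurable f ->
  (nintegral mu (fun x => p (modulus f x)) < +oo)%E ->
  orlicz_space mu (EFin \o p) f.
Proof.
move=> mf fin; split => //; exists 1 => //.
by under eq_integral do rewrite mul1r.
Qed.

(** Together with [orlicz_norm_le], this lets the norm be computed with nonnegative real test
    functions: only moduli enter the integrals. *)
Lemma orlicz_norm_test g h : complex_measurable g -> nonneg_mfun h ->
  (nintegral mu (fun x => phi (h x)) <= 1)%E ->
  (nintegral mu (fun x => modulus g x * h x)%R <= normPsi g)%E.
Proof.
move=> mg [mh h0] h1; apply: ereal_sup_ubound; exists (fun x => (h x)%:C).
  have hE x : modulus (fun x => (h x)%:C) x = h x.
    by rewrite /modulus normc_real ger0_norm.
  split; last by under eq_integral do rewrite hE.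
  apply: orlicz_space_bounded_modular; first exact: complex_measurable_real.
  rewrite /nintegral; under eq_integral do rewrite hE.
  exact: le_lt_trans h1 (ltry _).
by apply: eq_integral => x _; rewrite Normc.normcM normc_real ger0_norm.
Qed.

Lemma orlicz_norm_le g (c : \bar R) :
  (forall h, nonneg_mfun h -> (nintegral mu (fun x => phi (h x)) <= 1)%E ->
    (nintegral mu (fun x => modulus g x * h x)%R <= c)%E) ->
  (normPsi g <= c)%E.
Proof.
move=> hc; apply: ub_ereal_sup => _ [f [[mf _] hf] <-].
have := hc _ (nonneg_mfun_modulus mf) hf.
rewrite (_ : nintegral _ _ = \int[mu]_x (Normc.normc (g x * f x))%:E)%E //.
by apply: eq_integral => x _; rewrite Normc.normcM.
Qed.

Lemma orlicz_norm_ge0 g : (0 <= normPsi g)%E.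
Proof.
apply: le_trans (ereal_sup_ubound _); last first.
  exists (fun=> 0) => //; split.
    split; first by split; exact: measurable_cst.
    exists 1 => //; rewrite integral0_eq // => x _ /=.
    by rewrite /modulus Normc.normc0 mulr0 (young_0 yphi).
  rewrite integral0_eq // => x _ /=.
  by rewrite /modulus Normc.normc0 (young_0 yphi).
by apply: integral_ge0 => x _; rewrite lee_fin normc_ge0.
Qed.

Lemma luxemburg_norm_ge0 (p : R -> R) f : (0 <= luxemburg_norm mu (EFin \o p) f)%E.
Proof. by apply: le_ereal_inf_tmp => _ [a [a0 _] <-]; rewrite lee_fin ltW. Qed.

Lemma orlicz_norm_fin g : LPsi g -> (normPsi g < +oo)%E.
Proof.
move=> Lg; have [mg _] := Lg; have ng := nonneg_mfun_modulus mg.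
have fin := modular_finite ypsi Lg.
apply: (@le_lt_trans _ _ (nintegral mu (fun x => psi (modulus g x)) + 1)%E); last first.
  by rewrite lte_add_pinfty // ltry.
apply: orlicz_norm_le => h nh h1.
have npsi := nonneg_mfun_young ypsi ng.
have nphi := nonneg_mfun_young yphi nh.
apply: (@le_trans _ _ (nintegral mu (fun x => psi (modulus g x) + phi (h x)))).
  apply: nintegral_le; first exact: nonneg_mfunM.
    exact: nonneg_mfunD.
  by move=> x; rewrite mulrC addrC; apply: (conj_young cpp); [case: nh|case: ng].
by rewrite nintegralD // leeD2l.
Qed.

Lemma scaled_modular_le1 (p : R -> R) h (B : R) : young_fun k p -> nonneg_mfun h ->
  1 <= B -> (nintegral mu (fun x => p (h x)) <= B%:E)%E ->
  (nintegral mu (fun x => p (B^-1 * h x)%R) <= 1)%E.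
Proof.
move=> yp nh B1 hB.
have B0 : 0 < B by apply: lt_le_trans B1.
have nph := nonneg_mfun_young yp nh.
apply: (@le_trans _ _ (nintegral mu (fun x => B^-1 * p (h x)))).
  apply: nintegral_le.
  - by apply: (nonneg_mfun_young yp); apply: nonneg_mfunZ => //; rewrite invr_ge0 ltW.
  - by apply: nonneg_mfunZ => //; rewrite invr_ge0 ltW.
  move=> x; apply: (young_contract _ yp).
  by rewrite invr_ge0 (ltW B0) /= invf_le1.
rewrite nintegralZ ?invr_ge0 ?(ltW B0) //.
apply: (@le_trans _ _ (B^-1%:E * B%:E)%E).
  by rewrite lee_wpmul2l // lee_fin invr_ge0 ltW.
by rewrite -EFinM mulVf // gt_eqF.
Qed.

Lemma luxemburg_norm_fin f : LPhi f -> (normPhi f < +oo)%E.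
Proof.
move=> Lf; have [mf _] := Lf; have nf := nonneg_mfun_modulus mf.
have := modular_finite yphi Lf.
case E : (nintegral _ _) => [A| |] // _; last first.
  have : (0 <= nintegral mu (fun x => phi (modulus f x)))%E.
    by apply: nintegral_ge0 => x; exact: young_ge0 yphi _.
  by rewrite E.
pose B := Num.max A 1.
have B1 : 1 <= B by rewrite le_max lexx orbT.
apply: (@le_lt_trans _ _ B%:E); last exact: ltry.
apply: ereal_inf_lbound; exists B => //; split; first exact: lt_le_trans B1.
have hA : (nintegral mu (fun x => phi (modulus f x)) <= B%:E)%E.
  by rewrite E lee_fin le_max lexx.
have := scaled_modular_le1 yphi nf B1 hA.
by under eq_fun do rewrite mulrC.
Qed.

Lemma orlicz_holder f g : LPhi f -> LPsi g ->
  (nintegral mu (fun x => modulus f x * modulus g x)%R <= normPhi f * normPsi g)%E.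
Proof.
move=> Lf Lg; have [mf _] := Lf; have [mg _] := Lg.
have nf := nonneg_mfun_modulus mf; have ng := nonneg_mfun_modulus mg.
have fin := orlicz_norm_fin Lg; have ge0 := orlicz_norm_ge0 g.
have key (a : R) : 0 < a -> (\int[mu]_x (EFin \o phi) (modulus f x / a)%R <= 1)%E ->
    (nintegral mu (fun x => modulus f x * modulus g x)%R <= a%:E * normPsi g)%E.
  move=> a0 ha.
  have nfa : nonneg_mfun (fun x : borel G => a^-1 * modulus f x).
    by apply: nonneg_mfunZ => //; rewrite invr_ge0 ltW.
  have := @orlicz_norm_test g _ mg nfa.
  rewrite {1}/nintegral; under eq_integral do rewrite mulrC.
  move=> /(_ ha) h.
  rewrite (_ : (fun _ => _) = (fun x => a * (modulus g x * (a^-1 * modulus f x)))).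
    rewrite nintegralZ ?(ltW a0) //; last exact: nonneg_mfunM.
    by rewrite lee_wpmul2l // lee_fin ltW.
  by apply/funext => x; field; rewrite gt_eqF.
move: fin ge0 key; case: (normPsi g) => [N| |] // _.
(* The infimum over [a] is reached by dividing by the norm of [g], so norm 0 is treated apart, with
   any single admissible [a]. *)
rewrite lee_fin le_eqVlt => /predU1P[<- key|N0 key].
  have [_ [a [a0 ha] _] _] := ereal_inf_lt (luxemburg_norm_fin Lf).
  by rewrite mule0; have := key a a0 ha; rewrite mule0.
rewrite -lee_pdivrMr //; apply: le_ereal_inf_tmp => _ [a [a0 ha] <-].
rewrite lee_pdivrMr //; exact: key.
Qed.

End Orlicz.

(** * Modulars on the unit ball and averages on [L^Psi(G)] *)

Section OrliczAverages.
Context {R : realType} {G : topGroupType}.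
Variable mu : {measure set (borel G) -> \bar R}.
Hypothesis haar : left_haar mu.
Variables (k : R) (phi psi : R -> R).
Hypothesis (yphi : young_fun k phi) (ypsi : young_fun k psi).
Hypothesis (cpp : conj_fun phi psi) (k_gt0 : 0 < k).
Implicit Types (f g : G -> R[i]) (h : borel G -> R).

Notation LPhi := (orlicz_space mu (EFin \o phi)).
Notation LPsi := (orlicz_space mu (EFin \o psi)).
Notation normPhi := (luxemburg_norm mu (EFin \o phi)).
Notation normPsi := (orlicz_norm mu (EFin \o phi)).

(* Testing against [h = psi |g| / (k |g|)], for which [phi h <= |g| h / 2]. *)
Lemma orlicz_norm_modular g : LPsi g -> (normPsi g <= 1)%E ->
  (nintegral mu (fun x => psi (modulus g x)) <= k%:E)%E.
Proof.
move=> Lg g1; have [mg _] := Lg; have ng := nonneg_mfun_modulus mg.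
have [_ g0] := ng.
have npsi := nonneg_mfun_young ypsi ng.
have fin := modular_finite k_gt0 ypsi Lg.
set h : borel G -> R := fun x => psi (modulus g x) / (k * modulus g x).
have nh : nonneg_mfun h.
  apply: nonneg_mfunM => //.
  split => [|x]; last by rewrite invr_ge0 mulr_ge0 // ltW.
  have -> : (fun x : borel G => (k * modulus g x)^-1) =
      (fun x => k^-1 * (modulus g x)^-1).
    by apply/funext => x; rewrite invfM.
  apply: measurable_funM => //.
  under eq_fun do rewrite -powR_inv1 //.
  by apply: (measurableT_comp (measurable_powR (-1))); case: ng.
have nphi := nonneg_mfun_young yphi nh.
have hphi x : phi (h x) <= (2 * k)^-1 * psi (modulus g x).
  have := g0 x; rewrite le_eqVlt => /predU1P[gx|gx].
    by rewrite /h -gx mulr0 invr0 mulr0 (young_0 yphi) (young_0 ypsi) mulr0.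
  by rewrite mulrC; apply: conj_quotient ypsi cpp k_gt0 gx.
have hg x : modulus g x * h x = k^-1 * psi (modulus g x).
  have := g0 x; rewrite le_eqVlt => /predU1P[gx|gx].
    by rewrite -gx mul0r (young_0 ypsi) mulr0.
  by rewrite /h; field; rewrite !gt_eqF.
have ik0 : 0 <= k^-1 by rewrite invr_ge0 ltW.
have hgI : nintegral mu (fun x => modulus g x * h x) =
    (k^-1%:E * nintegral mu (fun x => psi (modulus g x)))%E.
  by under eq_fun do rewrite hg; rewrite nintegralZ.
have BI : (nintegral mu (fun x => phi (h x)) <=
    (2 * k)^-1%:E * nintegral mu (fun x => psi (modulus g x)))%E.
  have k20 : 0 <= (2 * k)^-1 by rewrite invr_ge0 mulr_ge0 // ltW.
  rewrite -nintegralZ //; apply: nintegral_le => //.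
  by apply: nonneg_mfunZ.
have [A A0 EA] : exists2 A, 0 <= A & nintegral mu (fun x => psi (modulus g x)) = A%:E.
  have : (0 <= nintegral mu (fun x => psi (modulus g x)))%E by apply: nintegral_ge0; case: npsi.
  by case: (nintegral _ _) fin => // A _; exists A.
have [B B0 EB] : exists2 B, 0 <= B & nintegral mu (fun x => phi (h x)) = B%:E.
  have : (0 <= nintegral mu (fun x => phi (h x)))%E by apply: nintegral_ge0; case: nphi.
  move: BI; rewrite EA; case: (nintegral _ (fun x => phi _)) => // B _; exists B => //.
rewrite EA in hgI BI *; rewrite -EFinM in hgI; rewrite -EFinM EB lee_fin in BI.
rewrite lee_fin.
(* If the modular [B] of [h] is at most 1, then [h] is itself a test function and gives [A <= k].
   Otherwise [B^-1 * h] is one, and gives [k^-1 * A <= B]; the gain of 2 in [BI] turns this into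
   [z <= z / 2] for [z = k^-1 * A], so [B <= 0], a contradiction. *)
have [B1|B1] := leP B 1.
  have := orlicz_norm_test (mu := mu) (phi := phi) mg nh; rewrite EB => /(_ B1).
  move=> /le_trans /(_ g1); rewrite hgI lee_fin.
  by rewrite mulrC ler_pdivrMr // mul1r.
have hB := scaled_modular_le1 yphi nh (ltW B1).
have {hB} : (nintegral mu (fun x => phi (B^-1 * h x)%R) <= 1)%E by apply: hB; rewrite EB.
have nhB : nonneg_mfun (fun x => B^-1 * h x) by apply: nonneg_mfunZ => //; rewrite invr_ge0.
move=> /(orlicz_norm_test (mu := mu) (phi := phi) mg nhB) /le_trans /(_ g1).
rewrite (_ : (fun _ => _) = (fun x => B^-1 * (modulus g x * h x))); last first.
  by apply/funext => x; rewrite mulrCA.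
rewrite nintegralZ ?invr_ge0 //; last exact: nonneg_mfunM.
rewrite hgI -EFinM lee_fin mulrC ler_pdivrMr ?(lt_trans ltr01) // mul1r => h2.
have h3 : k^-1 * A <= (2 * k)^-1 * A by apply: le_trans BI.
move: h3; rewrite invfM -mulrA; set z := k^-1 * A => h3.
have z0 : z <= 0 by lra.
move: B1; rewrite ltNge => /negP; case; apply: le_trans ler01.
by apply: le_trans BI _; rewrite invfM -mulrA -/z; lra.
Qed.

Lemma orlicz_space_translate (p : R -> R) f (x : G) : young_fun k p ->
  orlicz_space mu (EFin \o p) f ->
  orlicz_space mu (EFin \o p) (fun y => f (x * y)%g).
Proof.
move=> yp Lf; have [mf _] := Lf; have nf := nonneg_mfun_modulus mf.
apply: orlicz_space_bounded_modular; first exact: complex_measurable_translate.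
rewrite (nintegral_translate haar x (nonneg_mfun_young yp nf)).
exact: modular_finite yp Lf.
Qed.

Lemma orlicz_norm_translate g (x : G) : complex_measurable g ->
  (normPsi (fun y => g (x * y)%g) <= normPsi g)%E.
Proof.
move=> mg; have ng := nonneg_mfun_modulus mg.
apply: orlicz_norm_le => h nh h1.
have nhx := nonneg_mfun_translate x^-1%g nh.
have := nintegral_translate haar x (nonneg_mfunM ng nhx).
under eq_fun do rewrite mulKg; move=> ->.
apply: orlicz_norm_test => //.
by rewrite (nintegral_translate haar x^-1%g (nonneg_mfun_young yphi nh)).
Qed.

(** The action of [T_nu] for the uniform probability [nu] on [s]; [modulus_avg_le] dominates it by
    the real average of the modulus. *)
Definition cavg (s : seq G) g (y : G) : R[i] :=
  ((size s)%:R^-1)%:C * \sum_(x <- s) g (x^-1 * y)%g.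

Lemma complex_measurableD f g : complex_measurable f -> complex_measurable g ->
  complex_measurable (fun x => f x + g x).
Proof.
move=> [rf if_] [rg ig]; split.
  under eq_fun do rewrite raddfD; exact: measurable_funD.
under eq_fun do rewrite raddfD; exact: measurable_funD.
Qed.

Lemma ReZ (a : R) (z : R[i]) : complex.Re (a%:C * z) = a * complex.Re z.
Proof. by case: z => x y /=; rewrite mul0r subr0. Qed.

Lemma ImZ (a : R) (z : R[i]) : complex.Im (a%:C * z) = a * complex.Im z.
Proof. by case: z => x y /=; rewrite mul0r addr0. Qed.

Lemma complex_measurable_avg s g : complex_measurable g ->
  complex_measurable (cavg s g).
Proof.
move=> mg; rewrite /cavg.
have [mr mi] : complex_measurable (fun y => \sum_(x <- s) g (x^-1 * y)%g).
  elim: s => [|x s IH].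
    by under eq_fun do rewrite big_nil; split; exact: measurable_cst.
  under eq_fun do rewrite big_cons.
  by apply: complex_measurableD => //; exact: complex_measurable_translate.
split.
  by under eq_fun do rewrite ReZ; apply: measurable_funM.
by under eq_fun do rewrite ImZ; apply: measurable_funM.
Qed.

Lemma modulus_avg_le s g y : modulus (cavg s g) y <= avg s (modulus g) y.
Proof.
rewrite /modulus /cavg Normc.normcM normc_real ger0_norm ?invr_ge0 //.
rewrite ler_wpM2l ?invr_ge0 //.
elim: s => [|x s IH]; first by rewrite !big_nil Normc.normc0.
by rewrite !big_cons; apply: le_trans (le_normcD _ _) _; rewrite lerD2l.
Qed.

(** [orlicz_norm_modular] puts the unit ball of [L^Psi(G)] inside the modular ball of radius [k], so
    [young_avg_small] with [M = k] gives one power that serves the whole ball. *)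
Lemma not_reiter_avg_small (c : R) : ~ reiter mu -> 0 < c ->
  exists2 s, s != [::] & forall g, LPsi g -> (normPsi g <= 1)%E ->
    (normPsi (cavg s g) <= c%:E)%E.
Proof.
move=> nr c0; have [s [r [s0 r01 hr]]] := not_reiter_contract haar nr.
have [n hn] := young_avg_small haar yphi ypsi cpp k_gt0 s0 r01 (ltW k_gt0) c0 hr.
exists (pow_seq s n); first exact: pow_seq_neq0.
move=> g Lg g1; have [mg _] := Lg; have ng := nonneg_mfun_modulus mg.
apply: orlicz_norm_le => h nh h1.
apply: le_trans (hn h _ nh ng h1 (orlicz_norm_modular Lg g1)).
have nT := nonneg_mfun_modulus (complex_measurable_avg (pow_seq s n) mg).
have na := nonneg_mfun_avg (pow_seq s n) ng.
apply: nintegral_le; try exact: nonneg_mfunM.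
by move=> y; rewrite mulrC ler_wpM2l ?modulus_avg_le //; case: nh.
Qed.

End OrliczAverages.

(** * The pairing on finitely supported measures *)

Section ComplexSums.
Context {R : realType}.
Implicit Types (z w : nat -> R[i]) (a : R).

(** Under this condition both [limn] in [csum] are genuine limits, as additivity requires. *)
Definition csummable z := cvgn (series (fun n => complex.Re (z n))) /\
  cvgn (series (fun n => complex.Im (z n))).

Lemma cvgn_series_dominated (r : nat -> R) (c : nat -> \bar R) :
  (forall n, (`|r n|%:E <= c n)%E) -> (\sum_(0 <= n <oo) c n < +oo)%E ->
  cvgn (series r).
Proof.
move=> rc fin; apply: normed_cvg.
have c0 n : (0 <= c n)%E by apply: le_trans (rc n); rewrite lee_fin.
have s0 : (0 <= \sum_(0 <= n <oo) c n)%E by apply: nneseries_ge0.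
apply: nondecreasing_is_cvgn.
  by apply/nondecreasing_seqP => n; rewrite /= /series /= big_nat_recr //= lerDl.
exists (fine (\sum_(0 <= n <oo) c n)%E) => _ [n _ <-].
rewrite -lee_fin fineK ?ge0_fin_numE // /series /= -sumEFin.
apply: le_trans (nneseries_lim_ge n (fun i _ _ => c0 i)).
by apply: lee_sum.
Qed.

Lemma csummable_dominated z (c : nat -> \bar R) :
  (forall n, ((Normc.normc (z n))%:E <= c n)%E) ->
  (\sum_(0 <= n <oo) c n < +oo)%E -> csummable z.
Proof.
move=> zc fin; split; apply: cvgn_series_dominated fin => n;
  apply: le_trans (zc n); rewrite lee_fin; [exact: normr_Re_le|exact: normr_Im_le].
Qed.

Lemma csumD z w : csummable z -> csummable w ->
  csummable (fun n => z n + w n) /\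
  csum (fun n => z n + w n) = csum z + csum w.
Proof.
move=> [rz iz] [rw iw].
have rE : (fun n => complex.Re (z n + w n)) =
    (fun n => complex.Re (z n)) + (fun n => complex.Re (w n)).
  by apply/funext => n; rewrite raddfD.
have iE : (fun n => complex.Im (z n + w n)) =
    (fun n => complex.Im (z n)) + (fun n => complex.Im (w n)).
  by apply/funext => n; rewrite raddfD.
rewrite /csummable /csum rE iE; split; last by rewrite !lim_seriesD.
by split; [exact: (is_cvg_seriesD rz rw)|exact: (is_cvg_seriesD iz iw)].
Qed.

Lemma csumZ a z : csummable z -> csummable (fun n => a%:C * z n) /\
  csum (fun n => a%:C * z n) = a%:C * csum z.
Proof.
move=> [rz iz].
have rE : (fun n => complex.Re (a%:C * z n)) = a *: (fun n => complex.Re (z n)).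
  by apply/funext => n; rewrite ReZ.
have iE : (fun n => complex.Im (a%:C * z n)) = a *: (fun n => complex.Im (z n)).
  by apply/funext => n; rewrite ImZ.
rewrite /csummable /csum rE iE; split; last rewrite !lim_seriesZ //.
  by split; [exact: (is_cvg_seriesZ rz)|exact: (is_cvg_seriesZ iz)].
by apply/eqP; rewrite eq_complex /= !mul0r subr0 addr0 !eqxx.
Qed.

Lemma csum_first z : (forall n, z n.+1 = 0) -> csum z = z 0%N.
Proof.
move=> z0.
have lim (r : nat -> R) : (forall n, r n.+1 = 0) -> limn (series r) = r 0%N.
  move=> r0; apply: cvg_lim => //.
  rewrite -(cvg_shiftS (series r)); apply: cvg_near_cst; near=> n.
  by rewrite /= /series /= big_nat_recl // big1 ?addr0 // => i _; rewrite r0.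
rewrite /csum !lim //; try by move=> n; rewrite z0.
by case: (z 0%N).
Unshelve. all: by end_near. Qed.

Lemma csum_sum (I : Type) (s : seq I) (z : I -> nat -> R[i]) :
  (forall i, csummable (z i)) ->
  csum (fun n => \sum_(i <- s) z i n) = \sum_(i <- s) csum (z i).
Proof.
move=> sz.
suff : csummable (fun n => \sum_(i <- s) z i n) /\
  csum (fun n => \sum_(i <- s) z i n) = \sum_(i <- s) csum (z i) by case.
elim: s => [|i s [IH1 IH2]].
  under eq_fun do rewrite big_nil.
  split; last by rewrite big_nil csum_first.
  by apply: (@csummable_dominated _ (fun=> 0%E)) => [n|]; rewrite ?Normc.normc0 ?eseries0.
under eq_fun do rewrite big_cons.
by rewrite big_cons -IH2; apply: csumD.
Qed.

End ComplexSums.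

Section ComplexIntegral.
Context {R : realType} {G : topGroupType}.
Variable mu : {measure set (borel G) -> \bar R}.
Implicit Types (f g : G -> R[i]) (a : R).

Definition cintegrable f :=
  mu.-integrable [set: borel G] (EFin \o (fun x => complex.Re (f x))) /\
  mu.-integrable [set: borel G] (EFin \o (fun x => complex.Im (f x))).

Lemma cintegrable_modulus f : complex_measurable f ->
  (nintegral mu (modulus f) < +oo)%E -> cintegrable f.
Proof.
move=> mf fin; have nf := nonneg_mfun_modulus mf; have [mr mi] := mf.
have int (r : borel G -> R) : measurable_fun [set: borel G] r ->
    (forall x, `|r x| <= modulus f x) -> mu.-integrable [set: borel G] (EFin \o r).
  move=> mr' hr; apply/integrableP; split; first exact/measurable_EFinP.
  apply: le_lt_trans fin.
  change (nintegral mu (fun x : borel G => `|r x|)%R <= nintegral mu (modulus f))%E.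
  exact: (nintegral_le mu (nonneg_mfun_norm mr') nf hr).
by split; apply: int => // x; [exact: normr_Re_le|exact: normr_Im_le].
Qed.

Lemma cintegralD f g : cintegrable f -> cintegrable g ->
  cintegrable (fun x => f x + g x) /\
  cintegral mu (fun x => f x + g x) = cintegral mu f + cintegral mu g.
Proof.
move=> [rf if_] [rg ig].
have rE : (fun x => complex.Re (f x + g x)) =
    (fun x => complex.Re (f x) + complex.Re (g x)).
  by apply/funext => n; rewrite raddfD.
have iE : (fun x => complex.Im (f x + g x)) =
    (fun x => complex.Im (f x) + complex.Im (g x)).
  by apply/funext => n; rewrite raddfD.
rewrite /cintegrable /cintegral rE iE !RintegralD //; split => //.
split.
  exact: (integrableD measurableT rf rg).
exact: (integrableD measurableT if_ ig).
Qed.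

Lemma cintegralZ a f : cintegrable f ->
  cintegrable (fun x => a%:C * f x) /\
  cintegral mu (fun x => a%:C * f x) = a%:C * cintegral mu f.
Proof.
move=> [rf if_].
have rE : (fun x => complex.Re (a%:C * f x)) = (fun x => a * complex.Re (f x)).
  by apply/funext => n; rewrite ReZ.
have iE : (fun x => complex.Im (a%:C * f x)) = (fun x => a * complex.Im (f x)).
  by apply/funext => n; rewrite ImZ.
rewrite /cintegrable /cintegral rE iE !RintegralZl //; split.
  split.
    exact: (integrableZl measurableT a rf).
  exact: (integrableZl measurableT a if_).
by apply/eqP; rewrite eq_complex /= !mul0r subr0 addr0 !eqxx.
Qed.

Lemma cintegral0 : cintegral mu (fun=> 0) = 0.
Proof.
rewrite /cintegral /= /Rintegral.
by rewrite integral0_eq.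
Qed.

Lemma cintegral_sum (I : Type) (s : seq I) (h : I -> G -> R[i]) :
  (forall i, cintegrable (h i)) ->
  cintegrable (fun x => \sum_(i <- s) h i x) /\
  cintegral mu (fun x => \sum_(i <- s) h i x) = \sum_(i <- s) cintegral mu (h i).
Proof.
move=> ih; elim: s => [|i s [IH1 IH2]].
  under eq_fun do rewrite big_nil.
  rewrite big_nil cintegral0; split => //.
  by split; rewrite (_ : _ \o _ = cst 0%E) //; exact: integrable0.
under eq_fun do rewrite big_cons.
by rewrite big_cons -IH2; apply: cintegralD.
Qed.

(** The factor 2 comes from bounding real and imaginary parts separately; the estimate serves to
    dominate a series. *)
Lemma normc_cintegral_le f : complex_measurable f ->
  (nintegral mu (modulus f) < +oo)%E ->
  ((Normc.normc (cintegral mu f))%:E <= 2%:E * nintegral mu (modulus f))%E.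
Proof.
move=> mf fin; have nf := nonneg_mfun_modulus mf.
have [ir ii] := cintegrable_modulus mf fin.
have [mr mi] := mf.
have part (r : borel G -> R) : measurable_fun [set: borel G] r ->
    mu.-integrable [set: borel G] (EFin \o r) ->
    (forall x, `|r x| <= modulus f x) ->
    (`|\int[mu]_x r x|%:E <= nintegral mu (modulus f))%E.
  move=> mr' ir' hr; rewrite EFin_normr_Rintegral //.
  apply: le_trans (le_abse_integral mu measurableT _) _; first exact/measurable_EFinP.
  change (nintegral mu (fun x : borel G => `|r x|)%R <= nintegral mu (modulus f))%E.
  exact: (nintegral_le mu (nonneg_mfun_norm mr') nf hr).
apply: (@le_trans _ _ (`|complex.Re (cintegral mu f)| + `|complex.Im (cintegral mu f)|)%:E).
  by rewrite lee_fin normc_le_ReIm.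
rewrite EFinD.
have -> : (2%:E * nintegral mu (modulus f) =
    nintegral mu (modulus f) + nintegral mu (modulus f))%E.
  rewrite -[2%R]/(1 + 1 : R) EFinD ge0_muleDl ?lee_fin // !mul1e //.
by apply: leeD; apply: part => // x; [exact: normr_Re_le|exact: normr_Im_le].
Qed.

End ComplexIntegral.

Section Pairing.
Context {R : realType} {G : topGroupType}.
Variable mu : {measure set (borel G) -> \bar R}.
Hypothesis haar : left_haar mu.
Variables (k : R) (phi psi : R -> R).
Hypothesis (yphi : young_fun k phi) (ypsi : young_fun k psi).
Hypothesis (cpp : conj_fun phi psi) (k_gt0 : 0 < k).
Implicit Types (f g : G -> R[i]) (s : seq G).

Notation Phi := (EFin \o phi).
Notation Psi := (EFin \o psi).
Notation LPhi := (orlicz_space mu Phi).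
Notation LPsi := (orlicz_space mu Psi).
Notation normPhi := (luxemburg_norm mu Phi).
Notation normPsi := (orlicz_norm mu Phi).

Lemma complex_measurableM f g : complex_measurable f -> complex_measurable g ->
  complex_measurable (fun x => f x * g x).
Proof.
move=> [rf if_] [rg ig].
have RM (z w : R[i]) : complex.Re (z * w) =
    complex.Re z * complex.Re w - complex.Im z * complex.Im w by case: z; case: w.
have IM (z w : R[i]) : complex.Im (z * w) =
    complex.Re z * complex.Im w + complex.Im z * complex.Re w by case: z; case: w.
split.
  by under eq_fun do rewrite RM; apply: measurable_funB; apply: measurable_funM.
by under eq_fun do rewrite IM; apply: measurable_funD; apply: measurable_funM.
Qed.

Lemma translate_holder f g (x : G) : LPhi f -> LPsi g ->
  (nintegral mu (modulus (fun y => f y * g (x * y)%g)%R)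
    <= normPhi f * normPsi g)%E.
Proof.
move=> Lf Lg; have Lgx := orlicz_space_translate haar k_gt0 x ypsi Lg.
rewrite (_ : modulus _ = fun y : borel G => modulus f y * modulus (fun y => g (x * y)%g) y).
  apply: le_trans (orlicz_holder yphi ypsi cpp k_gt0 Lf Lgx) _.
  apply: lee_wpmul2l; first exact: luxemburg_norm_ge0.
  by apply: (orlicz_norm_translate haar yphi); case: Lg.
by apply/funext => y; rewrite /modulus Normc.normcM.
Qed.

Lemma norm_product_fin f g : LPhi f -> LPsi g -> (normPhi f * normPsi g < +oo)%E.
Proof.
move=> Lf Lg; apply: lte_mul_pinfty.
- exact: luxemburg_norm_ge0.
- by rewrite ge0_fin_numE ?(luxemburg_norm_fin yphi k_gt0 Lf) // luxemburg_norm_ge0.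
- exact: (orlicz_norm_fin yphi ypsi cpp k_gt0 Lg).
Qed.

(** [u x] is [f] paired with a left translate of [g], which is why pairing with a point mass is
    evaluation. *)
Lemma convolution_checkE f g x :
  convolution mu f (check g) x = cintegral mu (fun y => f y * g (x^-1 * y)%g).
Proof.
rewrite /convolution /check; congr (cintegral mu _); apply/funext => y.
by rewrite invgM invgK.
Qed.

(** The instance of [<u, T_nu> = \int u dnu] for uniform [nu]. The finite sum over [s] is moved out
    of the integral and out of the series, both controlled by the Orlicz-Hoelder inequality. *)
Lemma trace_avg s (T : op R G) (f g : nat -> G -> R[i]) u :
  (forall h, LPsi h -> T h = cavg s h) ->
  represents mu Phi Psi f g u ->
  trace_functional mu f g T = ((size s)%:R^-1)%:C * \sum_(x <- s) u x.
Proof.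
move=> hT [[Lf Lg fin] hu].
have mprod n x : complex_measurable (fun y => f n y * g n (x * y)%g).
  apply: complex_measurableM; first by case: (Lf n).
  by apply: complex_measurable_translate; case: (Lg n).
have fprod n x : (nintegral mu (modulus (fun y => f n y * g n (x * y)%g)%R) < +oo)%E.
  by apply: le_lt_trans (translate_holder x (Lf n) (Lg n)) _; exact: norm_product_fin.
have iprod n x : cintegrable mu (fun y => f n y * g n (x * y)%g).
  exact: cintegrable_modulus.
have sconv x : csummable (fun n => cintegral mu (fun y => f n y * g n (x * y)%g)).
  apply: (@csummable_dominated _ _ (fun n => 2%:E * (normPhi (f n) * normPsi (g n)))%E).
    move=> n; apply: le_trans (normc_cintegral_le (mprod n x) (fprod n x)) _.
    by apply: lee_wpmul2l => //; exact: translate_holder.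
  rewrite nneseriesZl => [|n _]; last first.
    by apply: mule_ge0; [exact: luxemburg_norm_ge0 | exact: (orlicz_norm_ge0 mu yphi)].
  exact: lte_mul_pinfty.
rewrite /trace_functional.
have -> : (fun n => cintegral mu (fun x => f n x * T (g n) x)) =
    (fun n => ((size s)%:R^-1)%:C *
      \sum_(x <- s) cintegral mu (fun y => f n y * g n (x^-1 * y)%g)).
  apply/funext => n; rewrite hT //.
  have [i1 <-] := cintegral_sum s (fun x => iprod n x^-1%g).
  have [_ <-] := cintegralZ ((size s)%:R^-1) i1.
  congr (cintegral mu _); apply/funext => y.
  by rewrite /cavg mulrCA -mulr_sumr.
have cs : csummable (fun n => \sum_(x <- s)
    cintegral mu (fun y => f n y * g n (x^-1 * y)%g)).
  elim: s {hT} => [|x s IH].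
    under eq_fun do rewrite big_nil.
    by apply: (@csummable_dominated _ _ (fun=> 0%E)) => [n|]; rewrite ?Normc.normc0 ?eseries0.
  under eq_fun do rewrite big_cons.
  by have [] := csumD (sconv x^-1%g) IH.
have [_ ->] := csumZ ((size s)%:R^-1) cs.
congr (_ * _); rewrite csum_sum //; apply: eq_bigr => x _.
by rewrite hu; congr csum; apply/funext => n; rewrite convolution_checkE.
Qed.

(** By [trace_avg] all representations of [u] give one value, so the choice made by [xget] does not
    matter; its default 0 is excluded because [u] has a representation. *)
Lemma pairing_avg s (T : op R G) u :
  (forall h, LPsi h -> T h = cavg s h) -> A_Phi mu Phi Psi u ->
  pairing mu Phi Psi u T = ((size s)%:R^-1)%:C * \sum_(x <- s) u x.
Proof.
move=> hT [_ [f [g fgu]]]; rewrite /pairing.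
case: xgetP => [z _ [f' [g' [fgu' ->]]]|/(_ (trace_functional mu f g T)) []].
  exact: trace_avg fgu'.
by exists f, g.
Qed.

End Pairing.

(** * Functions of A_Phi equal to 1 on a finite set *)

Section Bump.
Context {R : realType} {G : topGroupType}.
Variable mu : {measure set (borel G) -> \bar R}.
Hypotheses (hG : hausdorff_space G) (haar : left_haar mu).

(** The translate [x K], as a preimage so that measurability follows from that of left
    multiplication. *)
Definition ltrans (x : G) (K : set G) : set G := (fun y => x^-1 * y)%g @^-1` K.

Lemma ltrans_compact x K : compact K -> compact (ltrans x K).
Proof.
move=> cK; rewrite /ltrans -image_mulgl; apply: continuous_compact => //.
by apply: continuous_subspaceT; exact: mulgl_continuous.
Qed.

Lemma ltrans_borel x (A : set (borel G)) : measurable A ->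
  measurable (ltrans x A : set (borel G)).
Proof. by move=> mA; rewrite -[ltrans x A]setTI; exact: (measurable_mulgl x^-1%g). Qed.

Lemma haar_ltrans x (A : set (borel G)) : measurable A -> mu (ltrans x A) = mu A.
Proof. by move=> mA; exact: haar_preimage. Qed.

Lemma compact_fin_num (K : set G) : compact K -> mu K \is a fin_num.
Proof. by move=> cK; rewrite ge0_fin_numE //; case: haar => _ /(_ K cK). Qed.

Lemma haar_compact_gt0 : exists2 K : set G, compact K & (0 < mu K)%E.
Proof.
case: haar => mu0 _ _ inner _.
have : (0 < mu [set: G])%E by rewrite lt_def mu0 /=.
rewrite (inner _ openT) => /ereal_sup_gt [_ [K [cK _] <-] K0].
by exists K.
Qed.

(** Outer regularity gives an open [U] around [K] with little more measure, and [w K] stays inside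
    [U] for [w] near the identity. *)
Lemma ltrans_diff_small (K : set G) (e : R) : compact K -> 0 < e ->
  \forall w \near (1%g : G), (mu (ltrans w K `\` K) < e%:E)%E.
Proof.
move=> cK e0; have mK := compact_borel hG cK; have fK := compact_fin_num cK.
have [U [oU KU] Ue] : exists2 U : set G, open U /\ K `<=` U & (mu U < mu K + e%:E)%E.
  case: haar => _ _ outer _ _.
  have : (mu K < mu K + e%:E)%E by rewrite lteDl.
  rewrite {1}(outer _ mK) => /ereal_inf_lt [_ [U [oU KU] <-] hU].
  by exists U.
have mU := open_borel oU.
have near2 : \forall w \near (1%g : G), K `<=` (fun y => U (w * y)%g).
  (* Compactness as a near-covering property: it suffices to control [w] near 1 and [z] near each
     single [y] of [K]. *)
  apply: (compact_near_coveringP K).1 => // y Ky.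
  have Uy : nbhs ((1%g : G) * y)%g U by rewrite mul1g; apply: open_nbhs_nbhs; split => //; exact: KU.
  have := @mulg_continuous G (1%g, y) U Uy.
  move=> [[A B] /= [nA nB] AB]; exists (B, A) => //= -[z w] /= [Bz Aw].
  exact: (AB (w, z)).
near=> w.
have hw : K `<=` (fun y => U (w * y)%g) by near: w.
have sub : ltrans w K `\` K `<=` U `\` K.
  move=> y [wy nKy]; split => //; have := hw _ wy; by rewrite mulVKg.
apply: (@le_lt_trans _ _ (mu (U `\` K))).
  apply: le_measure => //; rewrite inE; apply: measurableD => //; exact: ltrans_borel.
rewrite measureD //; last first.
  by rewrite (lt_trans Ue) // ltey_eq fin_numD fK.
rewrite (setIidr KU) lteBlDl //.
Unshelve. all: by end_near. Qed.

(** Replacing [x0] by [x] changes the value by at most the measure of [x K] minus [x0 K], which left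
    invariance carries to a neighbourhood of the identity. *)
Lemma haar_inter_continuous (A K : set G) : compact A -> compact K ->
  continuous (fun x => fine (mu (A `&` ltrans x K))).
Proof.
move=> cA cK x0.
have mA := compact_borel hG cA; have mK := compact_borel hG cK.
have mx x : measurable (ltrans x K : set (borel G)) by exact: ltrans_borel.
have mI x : measurable (A `&` ltrans x K : set (borel G)) by apply: measurableI.
have fI x : mu (A `&` ltrans x K) \is a fin_num.
  rewrite ge0_fin_numE //; apply: le_lt_trans (_ : mu A < _)%E.
    by apply: le_measure; rewrite ?inE.
  by rewrite -ge0_fin_numE //; exact: compact_fin_num.
have fx x : mu (ltrans x K) \is a fin_num.
  by rewrite haar_ltrans //; exact: compact_fin_num.
(* The two translates have equal finite measure and the same intersection, so one estimate controls
   both directions. *)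
have diffC x y : mu (ltrans x K `\` ltrans y K) = mu (ltrans y K `\` ltrans x K).
  have h a : (mu (ltrans a K) < +oo)%E by rewrite -ge0_fin_numE.
  rewrite (measureD (mx x) (mx y) (h x)) (measureD (mx y) (mx x) (h y)).
  congr (_ - _)%E; last by rewrite setIC.
  exact: etrans (haar_ltrans x mK) (esym (haar_ltrans y mK)).
have step x y : fine (mu (A `&` ltrans x K)) <=
    fine (mu (A `&` ltrans y K)) + fine (mu (ltrans x K `\` ltrans y K)).
  have fd : mu (ltrans x K `\` ltrans y K) \is a fin_num.
    rewrite ge0_fin_numE //; apply: le_lt_trans (_ : mu (ltrans x K) < _)%E.
      by apply: le_measure; rewrite ?inE //; exact: measurableD.
    by rewrite -ge0_fin_numE.
  rewrite -fineD // fine_le ?fin_numD ?fI ?fd //.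
  have mD : measurable (ltrans x K `\` ltrans y K : set (borel G)) by exact: measurableD.
  apply: (@le_trans _ _ (mu ((A `&` ltrans y K) `|` (ltrans x K `\` ltrans y K)))).
    apply: le_measure; rewrite ?inE //; first exact: measurableU.
    by move=> z [Az xz]; have [yz|yz] := pselect (ltrans y K z); [left|right].
  exact: measureU2.
apply/cvgrPdist_le => e e0.
have := ltrans_diff_small cK e0 => hnear.
have cont : (x0^-1 * x)%g @[x --> x0] --> (1%g : G).
  rewrite -(mulVg x0); exact: mulgl_continuous.
have /cont hx := hnear.
near=> x.
have hd : (mu (ltrans x K `\` ltrans x0 K) < e%:E)%E.
  have -> : ltrans x K `\` ltrans x0 K = ltrans x0 (ltrans (x0^-1 * x)%g K `\` K).
    by rewrite /ltrans; apply/seteqP; split => y /=; rewrite invgM invgK mulgA mulgK.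
  rewrite haar_ltrans; first by near: x.
  by apply: measurableD => //; exact: ltrans_borel.
have {}hd : fine (mu (ltrans x K `\` ltrans x0 K)) <= e.
  rewrite -lee_fin fineK ?(ltW hd) // ge0_fin_numE //.
  exact: lt_trans hd (ltry _).
have s1 := step x0 x; have s2 := step x x0.
by rewrite diffC in s1; rewrite ler_norml; apply/andP; split; lra.
Unshelve. all: by end_near. Qed.

Lemma compact_cover_translates (K : set G) (s : seq G) : compact K ->
  exists2 A : set G, compact A & forall x, x \in s -> ltrans x K `<=` A.
Proof.
move=> cK; elim: s => [|x s [A cA hA]]; first by exists set0 => //; exact: compact0.
exists (ltrans x K `|` A); first by apply: compactU => //; exact: ltrans_compact.
move=> y; rewrite inE => /predU1P[->|ys] z hz; [by left|right].
exact: hA hz.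
Qed.

End Bump.

Section BumpFunction.
Context {R : realType} {G : topGroupType}.
Variable mu : {measure set (borel G) -> \bar R}.
Hypotheses (hG : hausdorff_space G) (haar : left_haar mu).
Variables (k : R) (phi psi : R -> R).
Hypothesis (yphi : young_fun k phi) (ypsi : young_fun k psi).
Hypothesis (cpp : conj_fun phi psi) (k_gt0 : 0 < k).

Notation Phi := (EFin \o phi).
Notation Psi := (EFin \o psi).

Lemma scaled_indic_orlicz (p : R -> R) (A : set G) (c : R) : young_fun k p ->
  compact A -> orlicz_space mu (EFin \o p) (fun y => (c * \1_A y)%:C).
Proof.
move=> yp cA; have mA := compact_borel hG cA.
apply: orlicz_space_bounded_modular.
  apply: (@complex_measurable_real R G (fun y : borel G => c * \1_A y)).
  by apply: measurable_funM => //; exact: measurable_indic.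
rewrite (_ : nintegral _ _ = nintegral mu (fun y => p `|c| * \1_A y)); last first.
  rewrite /nintegral; apply: eq_integral => y _; congr (_%:E).
  rewrite /modulus normc_real normrM indicE.
  by case: (y \in A); rewrite /= ?normr1 ?mulr1 // normr0 !mulr0 (young_0 yp).
rewrite nintegralZ; last 2 first.
- exact: young_ge0 yp _.
- by split => [|y]; [exact: measurable_indic | rewrite indicE].
apply: lte_mul_pinfty => //; first by rewrite lee_fin (young_ge0 yp).
rewrite /nintegral integral_indic // setIT.
by case: haar => _ /(_ A cA).
Qed.

Lemma orlicz_space0 (p : R -> R) : young_fun k p ->
  orlicz_space mu (EFin \o p) (fun=> 0 : R[i]).
Proof.
move=> yp; have := scaled_indic_orlicz 0 yp (@compact0 G).
by under eq_fun do rewrite mul0r.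
Qed.

Lemma orlicz_norm0 : orlicz_norm mu Phi (fun=> 0 : R[i]) = 0%E.
Proof.
apply/eqP; rewrite eq_le (orlicz_norm_ge0 mu yphi) andbT.
apply: orlicz_norm_le => h _ _; rewrite /nintegral integral0_eq // => y _.
by rewrite /modulus Normc.normc0 mul0r.
Qed.

Lemma first_represents (f g : G -> R[i]) : orlicz_space mu Phi f ->
  orlicz_space mu Psi g ->
  represents mu Phi Psi (fun n => if n is 0 then f else fun=> 0)
    (fun n => if n is 0 then g else fun=> 0) (convolution mu f (check g)).
Proof.
move=> Lf Lg.
split; last first.
  move=> x; rewrite csum_first // => n.
  rewrite /convolution -[RHS](cintegral0 mu); congr (cintegral mu _).
  by apply/funext => y; rewrite mul0r.
split; [by case; [|move=> n; exact: orlicz_space0]..|].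
pose c (n : nat) := (luxemburg_norm mu Phi (if n is 0 then f else fun=> 0%R) *
  orlicz_norm mu Phi (if n is 0 then g else fun=> 0%R))%E.
change (\sum_(0 <= n <oo) c n < +oo)%E.
have c_ge0 n : (0 <= c n)%E.
  by apply: mule_ge0; [exact: luxemburg_norm_ge0|exact: (orlicz_norm_ge0 mu yphi)].
rewrite nneseries_recl // eseries0; last by case=> // n _ _; rewrite /c orlicz_norm0 mule0.
by rewrite adde0; exact: (norm_product_fin yphi ypsi cpp k_gt0 Lf Lg).
Qed.

(** Take [K] compact of positive measure and [A] compact containing [x K] for all [x] in [s]. The
    convolution of [\1_A / mu K] with the check of [\1_K] has value [mu (A]&[x K) / mu K] at [x],
    which is 1 on [s]. *)
Lemma A_Phi_eq1 (s : seq G) :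
  exists2 u, A_Phi mu Phi Psi u & forall x, x \in s -> u x = 1.
Proof.
have [K cK K0] := haar_compact_gt0 haar.
have [A cA hA] := compact_cover_translates s cK.
have mK := compact_borel hG cK; have mA := compact_borel hG cA.
have fK := compact_fin_num haar cK.
pose c := fine (mu K).
have c0 : 0 < c by rewrite -lte_fin fineK.
pose f y := (c^-1 * \1_A y)%:C : R[i].
pose g y := (1 * \1_K y)%:C : R[i].
have Lf : orlicz_space mu Phi f by exact: scaled_indic_orlicz.
have Lg : orlicz_space mu Psi g by exact: scaled_indic_orlicz.
have uE x : convolution mu f (check g) x =
    (c^-1 * fine (mu (A `&` ltrans x K)))%:C.
  have mx : measurable (A `&` ltrans x K : set (borel G)).
    by apply: measurableI => //; exact: ltrans_borel.
  rewrite convolution_checkE /cintegral.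
  rewrite (_ : (fun y => complex.Re _) = (fun y => c^-1 * \1_(A `&` ltrans x K) y)).
    rewrite (_ : (fun y => complex.Im _) = cst 0); last first.
      by apply/funext => y; rewrite /f /g /= mulr0 mul0r addr0.
    have nI : nonneg_mfun (\1_(A `&` ltrans x K) : borel G -> R).
      by split => [|y]; [exact: measurable_indic | rewrite indicE].
    have ic0 : 0 <= c^-1 by rewrite invr_ge0 ltW.
    rewrite /Rintegral -/(nintegral mu _) (nintegralZ mu ic0 nI).
    rewrite /nintegral integral_indic // setIT integral0 fineM //.
    rewrite ge0_fin_numE //; apply: le_lt_trans (_ : mu A < _)%E.
      by apply: le_measure; rewrite ?inE.
    by case: haar => _ /(_ A cA).
  apply/funext => y; rewrite /f /g /= mulr0 subr0 mul1r -mulrA; congr (_ * _).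
  by rewrite indicI /=.
exists (convolution mu f (check g)).
  split; last by do 2 eexists; exact: first_represents.
  split; rewrite (funext uE) /=; last by move=> x; exact: cvg_cst.
  move=> x; apply: cvgM; first exact: cvg_cst.
  exact: (haar_inter_continuous hG haar cA cK).
move=> x xs; rewrite uE setIidr; last exact: hA.
by rewrite (haar_ltrans haar x mK) mulVf ?gt_eqF.
Qed.

End BumpFunction.

(** * Finitely supported measures as radon measures *)

Section PointMean.
Context {R : realType} {G : topGroupType}.
Implicit Types (s : seq G) (A : set (borel G)).

(** Entries count with multiplicity, as in [avg]. The default of [nth] is never read, and an empty
    [s] gives the zero measure. *)
Definition point_mean s : set (borel G) -> \bar R :=
  mscale ((size s)%:R^-1)%:nng
    (msum (fun n => dirac (nth (1%g : G) s n : borel G)) (size s)).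

HB.instance Definition _ s := Measure.on (point_mean s).

Lemma point_meanE s A : point_mean s A = ((size s)%:R^-1 * \sum_(x <- s) \1_A x)%:E.
Proof.
rewrite /point_mean /mscale /= /msum EFinM; congr (_ * _)%E.
rewrite -sumEFin (big_nth 1%g) big_mkord.
by [].
Qed.

Let point_mean_fin s : fin_num_fun (point_mean s).
Proof. by move=> A mA; rewrite point_meanE. Qed.

HB.instance Definition _ s :=
  Measure_isFinite.Build _ _ _ (point_mean s) (@point_mean_fin s).

Lemma integral_point_mean s (r : borel G -> R) : nonneg_mfun r ->
  (\int[point_mean s]_x (r x)%:E = ((size s)%:R^-1 * \sum_(x <- s) r x)%:E)%E.
Proof.
move=> [mr r0]; have mr' := (measurable_EFinP _ _).2 mr.
rewrite ge0_integral_mscale //; last by move=> x _; rewrite lee_fin.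
rewrite ge0_integral_measure_sum //; last by move=> x _; rewrite lee_fin.
rewrite EFinM; congr (_ * _)%E.
rewrite -sumEFin (big_nth 1%g) big_mkord.
by apply: eq_bigr => i _; rewrite integral_dirac // diracT mul1e.
Qed.

Lemma Rintegral_point_mean s (r : borel G -> R) : measurable_fun [set: borel G] r ->
  \int[point_mean s]_x r x = (size s)%:R^-1 * \sum_(x <- s) r x.
Proof.
move=> mr; have nr := nonneg_mfun_norm mr.
have abs_ge x : 0 <= `|r x| + r x by rewrite -lerBlDr sub0r ler_normr lexx orbT.
have abs_le x : 0 <= `|r x| - r x by rewrite subr_ge0 ler_norm.
have np : nonneg_mfun (fun x => `|r x| + r x).
  by split => //; apply: measurable_funD => //; case: nr.
have nq : nonneg_mfun (fun x => `|r x| - r x).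
  by split => //; apply: measurable_funB => //; case: nr.
have int (h : borel G -> R) : nonneg_mfun h ->
    (point_mean s).-integrable [set: borel G] (EFin \o h).
  move=> nh; have [mh h0] := nh; apply/integrableP; split; first exact/measurable_EFinP.
  under eq_integral do rewrite /= ger0_norm //.
  by rewrite integral_point_mean // ltry.
(* [2 * r] is a difference of two nonnegative functions, to which the nonnegative case applies; the
   factor 2 is cancelled at the end. *)
have E : \int[point_mean s]_x (2 * r x) = (size s)%:R^-1 * \sum_(x <- s) (2 * r x).
  rewrite (_ : (fun x => 2 * r x) = fun x => (`|r x| + r x) - (`|r x| - r x)); last first.
    by apply/funext => x; ring.
  rewrite RintegralB //; [|exact: int..].
  rewrite /Rintegral !integral_point_mean //= -mulrBr -sumrB.
  by congr (_ * _); apply: eq_bigr => x _; ring.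
have ir : (point_mean s).-integrable [set: borel G] (EFin \o r).
  apply/integrableP; split; first exact/measurable_EFinP.
  rewrite (_ : (fun x => _) = fun x : borel G => (`|r x|)%:E) //.
  by rewrite integral_point_mean // ltry.
move: E; rewrite RintegralZl // -mulr_sumr mulrCA.
by move=> /mulfI; apply.
Qed.

Lemma cintegral_point_mean s (f : G -> R[i]) : complex_measurable f ->
  cintegral (point_mean s) f = ((size s)%:R^-1)%:C * \sum_(x <- s) f x.
Proof.
move=> [mr mi]; rewrite /cintegral !Rintegral_point_mean //.
by rewrite -!raddf_sum; apply/eqP; rewrite eq_complex ReZ ImZ /= !eqxx.
Qed.

End PointMean.

Section PositiveCharge.
Context {R : realType} {G : topGroupType}.
Variable nu : {charge set (borel G) -> \bar R}.
Hypothesis nu_ge0 : forall A : set (borel G), measurable A -> (0 <= nu A)%E.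
Implicit Types A : set (borel G).

(** This holds for whichever Hahn decomposition was picked: [nu] is at most 0 on subsets of the
    negative set, and here also at least 0. *)
Lemma neg_part_eq0 A : measurable A -> neg_part nu A = 0%E.
Proof.
move=> mA; rewrite /neg_part; case: (hahn_sets nu) => -[P N] /= PN.
have [_ [mN N_le0] _ _] := PN.
have mAN : measurable (A `&` N) by exact: measurableI.
rewrite jordan_negE charge.cjordan_negE /crestr0. rewrite mem_set // /crestr.
suff -> : nu (A `&` N) = 0%E by rewrite oppe0.
by apply/eqP; rewrite eq_le nu_ge0 // andbT N_le0.
Qed.

Lemma pos_part_eq A : measurable A -> pos_part nu A = nu A.
Proof.
move=> mA; rewrite (jordan_decomp (projT2 (hahn_sets nu)) mA).
change (pos_part nu A = pos_part nu A + (-1)%:E * neg_part nu A)%E.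
by rewrite neg_part_eq0 // mule0 adde0.
Qed.

Lemma variation_eq A : measurable A -> Defs.variation nu A = nu A.
Proof.
move=> mA; change (pos_part nu A + neg_part nu A = nu A)%E.
by rewrite neg_part_eq0 // pos_part_eq // adde0.
Qed.

Lemma charge_integral_pos (m : {measure set (borel G) -> \bar R}) (f : G -> R[i]) :
  (forall A, measurable A -> nu A = m A) -> charge_integral nu f = cintegral m f.
Proof.
move=> num; rewrite /charge_integral.
have neg0 (r : borel G -> \bar R) : (\int[neg_part nu]_x r x = 0)%E.
  rewrite (eq_measure_integral mzero) ?integral_measure_zero // => A mA _.
  by rewrite neg_part_eq0.
have posE (r : borel G -> \bar R) : (\int[pos_part nu]_x r x = \int[m]_x r x)%E.
  by apply: eq_measure_integral => A mA _; rewrite pos_part_eq // num.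
have -> : cintegral (neg_part nu) f = 0 by rewrite /cintegral /Rintegral !neg0.
by rewrite subr0 /cintegral /Rintegral !posE.
Qed.

End PositiveCharge.

Section UniformMeasure.
Context {R : realType} {G : topGroupType}.
Hypothesis hG : hausdorff_space G.
Implicit Types (s : seq G) (A : set (borel G)).

(** The finite set of entries of [s] lying in [A] is compact and carries all the mass of [A]. *)
Lemma point_mean_radon s :
  radon_charge (charge_of_finite_measure (point_mean s : set (borel G) -> \bar R)).
Proof.
set nu : {charge set (borel G) -> \bar R} := charge_of_finite_measure _.
have nuE (A : set (borel G)) : nu A = point_mean s A by [].
have nu0 A : measurable A -> (0 <= nu A)%E by move=> mA; rewrite nuE.
move=> A mA; rewrite variation_eq //; apply/eqP; rewrite eq_le; apply/andP; split.
  apply: ereal_sup_ubound; exists (A `&` [set` s]).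
    split; last exact: subIsetl.
    by apply: finite_compact; apply: finite_setIr; exact: finite_seq.
  rewrite variation_eq //; last first.
    apply: compact_borel => //.
    by apply: finite_compact; apply: finite_setIr; exact: finite_seq.
  rewrite [LHS]point_meanE [RHS]point_meanE; congr (_ * _)%:E.
  by apply: eq_big_seq => x xs; rewrite !indicE in_setI [x \in [set` s]]mem_set // andbT.
apply: ub_ereal_sup => _ [K [cK KA] <-].
have mK := compact_borel hG cK.
rewrite variation_eq //.
by apply: (@le_measure _ _ _ (point_mean s)); rewrite ?inE.
Qed.

Lemma zero_radon : radon_charge (czero : {charge set (borel G) -> \bar R}).
Proof.
have c0 A : measurable A -> (0 <= (czero : {charge set (borel G) -> \bar R}) A)%E by [].
move=> A mA; rewrite variation_eq //; apply/eqP; rewrite eq_le; apply/andP; split.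
  apply: ereal_sup_ubound; exists set0; last by rewrite variation_eq.
  by split; [exact: compact0|exact: sub0set].
apply: ub_ereal_sup => _ [K [cK KA] <-].
by rewrite variation_eq //; exact: compact_borel.
Qed.

Lemma uniform_measure s : s != [::] -> exists nu : radon_cmeasure R G,
  probability_cmeasure nu /\
  forall g : G -> R[i], complex_measurable g -> conv_op nu g = cavg s g.
Proof.
move=> s0; exists (RadonCMeasure (point_mean_radon s) zero_radon); split.
  split => [A mA|A mA|] //=.
  rewrite [LHS]point_meanE; congr (_%:E).
  under eq_bigr do rewrite indicT.
  rewrite big_const_seq count_predT iter_addr addr0 mulVf //.
  by rewrite pnatr_eq0 size_eq0.
move=> g mg; apply/funext => x; rewrite /conv_op /cmeasure_integral /=.
have mgx : complex_measurable (fun y => g (y^-1 * x)%g).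
  have cx : continuous (fun y : G => (y^-1 * x)%g).
    move=> y; apply: (@continuous_comp _ _ _ (fun y : G => y^-1)%g (fun y : G => y * x)%g).
      exact: invg_continuous.
    exact: mulgr_continuous.
  case: mg => mr mi; split.
    exact: (measurableT_comp (f := fun z : borel G => complex.Re (g z)) mr (continuous_borel cx)).
  exact: (measurableT_comp (f := fun z : borel G => complex.Im (g z)) mi (continuous_borel cx)).
rewrite (@charge_integral_pos _ _ _ _ (point_mean s)) //.
rewrite (@charge_integral_pos _ _ _ _ mzero) //.
rewrite cintegral_point_mean //.
have -> : cintegral (mzero : {measure set (borel G) -> \bar R}) (fun y => g (y^-1 * x)%g) = 0.
  by rewrite /cintegral /Rintegral !integral_measure_zero.
by rewrite mulr0 addr0.
Qed.

End UniformMeasure.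

(** * Reiter's condition implies amenability *)

Section LocallyNull.
Context {R : realType} {G : topGroupType}.
Variable mu : {measure set (borel G) -> \bar R}.
Hypotheses (hG : hausdorff_space G) (haar : left_haar mu).
Implicit Types (r v : borel G -> R) (N : set G).

(** Inner regularity is available on open sets, so [A] is first enclosed in an open [U] of finite
    measure; countably many compact sets exhaust [U] up to a null set, and [N] is null in each. *)
Lemma negligible_finite_locally_null (A : set (borel G)) N : measurable A ->
  (mu A < +oo)%E -> locally_null mu N -> mu.-negligible (N `&` A).
Proof.
move=> mA fA nN; have [_ _ outer inner _] := haar.
have [U [oU AU] fU] : exists2 U : set G, open U /\ A `<=` U & (mu U < +oo)%E.
  move: fA; rewrite (outer _ mA) => /ereal_inf_lt [_ [U [oU AU] <-] hU].
  by exists U.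
have mU := open_borel oU.
have finU : mu U \is a fin_num by rewrite ge0_fin_numE.
have hK n : exists K : set G, [/\ compact K, K `<=` U &
    (mu (U `\` K) < n.+1%:R^-1%:E)%E].
  have : (mu U - n.+1%:R^-1%:E < mu U)%E.
    by rewrite lteBlDr // lteDl // lte_fin invr_gt0 ltr0n.
  rewrite {2}(inner _ oU) => /ereal_sup_gt [_ [K [cK KU] <-] hKU].
  exists K; split => //; have mK := compact_borel hG cK.
  rewrite measureD // (setIidr KU).
  rewrite lteBlDr //; last exact: compact_fin_num.
  by move: hKU; rewrite lteBlDr // addeC.
have [K {hK} cK] := choice hK.
apply: (@negligibleS _ (borel G) _ mu ((\bigcup_n (N `&` K n)) `|` (U `\` \bigcup_n K n))).
  move=> x [Nx Ax]; have [[n _ Kx]|nKx] := pselect ((\bigcup_n K n) x).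
    by left; exists n.
  by right; split => //; exact: AU.
apply: negligibleU.
  by apply: negligible_bigcup => n; apply: nN; case: (cK n).
have mK n : measurable (K n : set (borel G)) by apply: compact_borel => //; case: (cK n).
have mUK : measurable (U `\` \bigcup_n K n : set (borel G)).
  by apply: measurableD => //; exact: bigcup_measurable.
apply/negligibleP => //; apply/eqP; rewrite eq_le measure_ge0 andbT.
apply/lee_addgt0Pr => e e0; rewrite add0e.
have [n hn] : exists n, n.+1%:R^-1 <= e.
  exists (Num.bound e^-1); rewrite invf_ple ?posrE //.
  apply: ltW; apply: lt_trans (archi_boundP _) _; first by rewrite invr_ge0 ltW.
  by rewrite ltr_nat.
apply: (@le_trans _ _ (mu (U `\` K n))).
  apply: le_measure; rewrite ?inE //; first exact: measurableD.
  by move=> x [Ux nx]; split => // Kx; apply: nx; exists n.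
have [_ _ h] := cK n; apply: le_trans (ltW h) _.
by rewrite lee_fin.
Qed.

(** The Haar measure need not be sigma-finite, but an integrable [v] is positive only on a countable
    union of level sets, each of finite measure by Markov's inequality. *)
Lemma negligible_integrable_locally_null v N : nonneg_mfun v ->
  (nintegral mu v < +oo)%E -> locally_null mu N ->
  mu.-negligible (N `&` [set x | 0 < v x]).
Proof.
move=> nv fin nN; have [mv v0] := nv.
pose A n : set (borel G) := [set x | n.+1%:R^-1 <= v x].
have mA n : measurable (A n).
  have := mv measurableT _ (measurable_itv `[n.+1%:R^-1, +oo[).
  by rewrite setTI; congr measurable; apply/seteqP; split => x /=; rewrite in_itv /= andbT.
apply: (@negligibleS _ (borel G) _ mu (\bigcup_n (N `&` A n))).
  move=> x [Nx /= vx]; exists (Num.bound (v x)^-1) => //; split => //.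
  rewrite /A /= invf_ple ?posrE //.
  apply: ltW; apply: lt_trans (archi_boundP _) _; first by rewrite invr_ge0 ltW.
  by rewrite ltr_nat.
apply: negligible_bigcup => n; rewrite setIC -setIC.
apply: negligible_finite_locally_null => //.
apply: (@le_lt_trans _ _ (n.+1%:R%:E * nintegral mu v)%E); last first.
  by apply: lte_mul_pinfty => //; rewrite lee_fin.
have -> : mu (A n) = nintegral mu (\1_(A n)) by rewrite /nintegral integral_indic // setIT.
rewrite -nintegralZ //.
apply: nintegral_le.
- by split => [|y]; [exact: measurable_indic | rewrite indicE].
- exact: nonneg_mfunZ.
move=> x; rewrite indicE; case: (boolP (x \in A n)) => [|_]; last by rewrite mulr_ge0.
by rewrite inE /A /= => h; rewrite -ler_pdivrMl // mulr1.
Qed.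

End LocallyNull.

Section EssBounded.
Context {R : realType} {G : topGroupType}.
Variable mu : {measure set (borel G) -> \bar R}.
Hypotheses (hG : hausdorff_space G) (haar : left_haar mu).
Implicit Types (r v : borel G -> R) (C : R).

Definition ess_bounded C r := measurable_fun [set: borel G] r /\
  locally_null mu [set x | C < `|r x|].

(** The pairing of L^oo with L^1 when L^oo is taken modulo locally null sets: the set where [r]
    exceeds [C] meets the set where [v] is nonzero in a genuinely null set. *)
Lemma integral_ess_bounded C r v : 0 <= C -> ess_bounded C r ->
  measurable_fun [set: borel G] v ->
  (nintegral mu (fun x => `|v x|)%R < +oo)%E ->
  mu.-integrable [set: borel G] (EFin \o (fun x => r x * v x)) /\
  `|\int[mu]_x (r x * v x)| <= C * fine (nintegral mu (fun x => `|v x|)).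
Proof.
move=> C0 [mr nr] mv fin.
have mrv : measurable_fun [set: borel G] (fun x => r x * v x) by exact: measurable_funM.
have nv := nonneg_mfun_norm mv.
have nrv := nonneg_mfun_norm mrv.
have fnum : nintegral mu (fun x => `|v x|) \is a fin_num.
  by rewrite ge0_fin_numE //; apply: nintegral_ge0; case: nv.
have bound : (nintegral mu (fun x => `|r x * v x|)%R <=
    (C * fine (nintegral mu (fun x => `|v x|)))%R%:E)%E.
  rewrite EFinM fineK // -nintegralZ //; apply: ae_ge0_le_integral.
  - exact: measurableT.
  - by move=> x _; rewrite lee_fin.
  - by apply/measurable_EFinP; case: nrv.
  - by move=> x _; rewrite lee_fin mulr_ge0.
  - by apply/measurable_EFinP; case: (nonneg_mfunZ C0 nv).
  have nN := negligible_integrable_locally_null hG haar nv fin nr.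
  apply: (@negligibleS _ (borel G) _ mu _ _ _ nN) => x /= h; have {h} : ~ `|r x * v x| <= C * `|v x|.
    by move=> h'; apply: h => _; rewrite lee_fin.
  rewrite normrM => /negP; rewrite -ltNge => h.
  have v0 : 0 < `|v x|.
    rewrite lt_def normr_ge0 andbT; apply/eqP => v0.
    by move: h; rewrite v0 !mulr0 ltxx.
  by split => //=; rewrite -(ltr_pM2r v0).
have int : mu.-integrable [set: borel G] (EFin \o (fun x => r x * v x)).
  apply/integrableP; split; first exact/measurable_EFinP.
  exact: le_lt_trans bound (ltry _).
split => //; rewrite -lee_fin EFin_normr_Rintegral //.
apply: le_trans bound.
apply: le_trans (le_abse_integral mu measurableT _) _ => //.
exact/measurable_EFinP.
Qed.

Lemma ess_boundedW C D r : C <= D -> ess_bounded C r -> ess_bounded D r.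
Proof.
move=> CD [mr nr]; split => // K cK.
by apply: negligibleS (nr K cK) => x [/= h Kx]; split => //=; exact: le_lt_trans h.
Qed.

Lemma ess_boundedD C D r v : ess_bounded C r -> ess_bounded D v ->
  ess_bounded (C + D) (fun x => r x + v x).
Proof.
move=> [mr nr] [mv nv]; split; first exact: measurable_funD.
move=> K cK; apply: negligibleS (negligibleU (nr K cK) (nv K cK)) => x [/= h Kx].
have [rC|rC] := ltP C `|r x|; first by left.
right; split => //=; rewrite ltNge; apply/negP => vD.
by move: h; rewrite ltNge (le_trans (ler_normD _ _)) // lerD.
Qed.

Lemma ess_boundedZ C a r : ess_bounded C r -> ess_bounded (`|a| * C) (fun x => a * r x).
Proof.
move=> [mr nr]; split; first exact: measurable_funM.
move=> K cK; apply: negligibleS (nr K cK) => x [/= h Kx]; split => //=.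
rewrite ltNge; apply/negP => rC.
by move: h; rewrite ltNge normrM ler_wpM2l.
Qed.

Lemma integral_translate r (x : G) : measurable_fun [set: borel G] r ->
  \int[mu]_y r (x * y)%g = \int[mu]_y r y.
Proof.
move=> mr; rewrite /Rintegral integralE [in RHS]integralE.
have mr' := (measurable_EFinP _ _).2 mr.
congr (fine (_ - _)%E).
- rewrite -(haar_integral haar x (measurable_funepos mr') (fun y => funepos_ge0 _ y)).
  by apply: eq_integral => y _; rewrite !funeposE.
- rewrite -(haar_integral haar x (measurable_funeneg mr') (fun y => funeneg_ge0 _ y)).
  by apply: eq_integral => y _; rewrite !funenegE.
Qed.

End EssBounded.

(** * The mean as a limit of densities along an ultrafilter *)

Section UltraLimit.
Context {R : realType} {I : Type} (U : set_system I) {UU : UltraFilter U}.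
Implicit Types (a b : I -> R).

Lemma ultra_fmap (T : Type) (f : I -> T) : UltraFilter (f @ U).
Proof.
split; first by apply: fmap_proper_filter; exact: ultra_proper.
move=> F pF UF; apply/seteqP; split => // A FA.
have [//|nA] := in_ultra_setVsetC (f @^-1` A) UU.
have : F (~` A) by apply: UF.
move=> FnA; have : F (A `&` ~` A) by exact: filterI.
by rewrite setICr => /filter_not_empty.
Qed.

Lemma ultra_bounded_cvg a C : (forall i, `|a i| <= C) -> cvg (a @ U).
Proof.
move=> aC; have := @segment_compact R (- C) C; rewrite compact_ultra.
move=> /(_ (a @ U) (ultra_fmap a)) [|l [_ al]].
  by have pU := ultra_proper; apply: nearW => i /=; rewrite in_itv /= -ler_norml.
by apply/cvg_ex; exists l.
Qed.

End UltraLimit.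

Section Mean.
Context {R : realType} {G : topGroupType}.
Variable mu : {measure set (borel G) -> \bar R}.
Hypotheses (hG : hausdorff_space G) (haar : left_haar mu).
Implicit Types (r : borel G -> R) (f g : G -> R[i]) (C : R).

(** Pairs of a finite list and a tolerance index, directed by inclusion and size, generate a filter;
    along any finer ultrafilter each single translation is eventually almost trivial. *)
Lemma reiter_ultra : reiter mu ->
  exists (I : Type) (U : set_system I) (w : I -> borel G -> R),
    [/\ UltraFilter U, forall i, nonneg_mfun (w i),
      forall i, nintegral mu (w i) = 1%E &
      forall (x : G) (e : R), 0 < e -> \forall i \near U,
        (nintegral mu (fun y => `|w i (x * y)%g - w i y|)%R <= e%:E)%E].
Proof.
move=> hr.
have /choice[w hw] (i : seq G * nat) : exists w : borel G -> R,
    [/\ nonneg_mfun w, nintegral mu w = 1%E &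
      forall x, x \in i.1 ->
        (nintegral mu (fun y => `|w (x^-1 * y)%g - w y|)%R <= i.2.+1%:R^-1%:E)%E].
  by apply: hr; rewrite invr_gt0.
pose F : set_system (seq G * nat) := [set A : set (seq G * nat) | exists (s : seq G) (n : nat),
  forall i : seq G * nat,
  {subset s <= i.1} -> (n <= i.2)%N -> A i].
have pF : ProperFilter F.
  split.
    by move=> [s [n /(_ (s, n))]]; apply.
  split.
  - by exists [::], 0%N.
  - move=> A B [s [n hA]] [t [k hB]]; exists (s ++ t), (maxn n k) => i st nk.
    split; [apply: hA|apply: hB].
    + by move=> x xs; apply: st; rewrite mem_cat xs.
    + by apply: leq_trans nk; exact: leq_maxl.
    + by move=> x xs; apply: st; rewrite mem_cat xs orbT.
    + by apply: leq_trans nk; exact: leq_maxr.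
  - by move=> A B AB [s [n hA]]; exists s, n => i si ni; apply: AB; exact: hA.
have [U [UU FU]] := ultraFilterLemma pF.
exists (seq G * nat)%type, U, w; split => //.
- by move=> i; case: (hw i).
- by move=> i; case: (hw i).
(* [reiter] translates by the inverse of a list entry, hence [x^-1] in the list. *)
move=> x e e0; apply: FU; exists [:: x^-1%g], (Num.bound e^-1) => i si ni.
have [_ _ h] := hw i; have := h x^-1%g (si _ (mem_head _ _)).
rewrite invgK => /le_trans; apply; rewrite lee_fin invf_ple ?posrE //.
apply: ltW; apply: lt_trans (archi_boundP _) _; first by rewrite invr_ge0 ltW.
by rewrite ltr_nat.
Qed.

Section Limit.
Variables (I : Type) (U : set_system I) (w : I -> borel G -> R).
Hypotheses (UU : UltraFilter U) (nw : forall i, nonneg_mfun (w i)).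
Hypothesis w1 : forall i, nintegral mu (w i) = 1%E.
Hypothesis winv : forall (x : G) (e : R), 0 < e -> \forall i \near U,
  (nintegral mu (fun y => `|w i (x * y)%g - w i y|)%R <= e%:E)%E.

(** The densities act on L^oo by integration; the ultrafilter limit stands in for a weak-* cluster
    point in the dual. *)
Definition rmean r : R := lim ((fun i => \int[mu]_y (r y * w i y)) @ U).

Lemma nintegral_norm_w i : nintegral mu (fun x => `|w i x|) = 1%E.
Proof.
by rewrite -(w1 i); congr nintegral; apply/funext => x; rewrite ger0_norm //; case: (nw i).
Qed.

Lemma ess_bounded_w i C r : 0 <= C -> ess_bounded mu C r ->
  mu.-integrable [set: borel G] (EFin \o (fun x => r x * w i x)) /\
  `|\int[mu]_x (r x * w i x)| <= C.
Proof.
move=> C0 bC; have [mw _] := nw i.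
have := integral_ess_bounded hG haar C0 bC mw.
by rewrite nintegral_norm_w /= mulr1; apply; exact: ltry.
Qed.

Let pU : ProperFilter U. Proof. exact: ultra_proper. Qed.

Lemma rmean_cvg C r : 0 <= C -> ess_bounded mu C r ->
  (fun i => \int[mu]_y (r y * w i y)) @ U --> rmean r.
Proof.
move=> C0 bC; have h : forall i, `|\int[mu]_y (r y * w i y)| <= C.
  by move=> i; case: (ess_bounded_w i C0 bC).
exact: ultra_bounded_cvg h.
Qed.

Lemma rmean_eqP C r (l : R) : 0 <= C -> ess_bounded mu C r ->
  (fun i => \int[mu]_y (r y * w i y)) @ U --> l -> rmean r = l.
Proof. by move=> C0 bC h; apply: cvg_lim. Qed.

Lemma rmean_norm C r : 0 <= C -> ess_bounded mu C r -> `|rmean r| <= C.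
Proof.
move=> C0 bC; have h := rmean_cvg C0 bC.
rewrite ler_norml; apply/andP; split.
  apply: limr_ge; first exact: cvgP h.
  by apply: nearW => i; have [_] := ess_bounded_w i C0 bC; rewrite ler_norml => /andP[].
apply: limr_le; first exact: cvgP h.
by apply: nearW => i; have [_] := ess_bounded_w i C0 bC; rewrite ler_norml => /andP[].
Qed.

Lemma rmean_ge0 C r : 0 <= C -> ess_bounded mu C r -> (forall x, 0 <= r x) ->
  0 <= rmean r.
Proof.
move=> C0 bC r0; apply: limr_ge; first exact: cvgP (rmean_cvg C0 bC).
apply: nearW => i; apply: Rintegral_ge0 => x _.
by rewrite mulr_ge0 //; case: (nw i).
Qed.

Lemma rmean1 : rmean (fun=> 1) = 1.
Proof.
rewrite /rmean (_ : (fun i => _) = cst 1); first exact: lim_cst.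
apply/funext => i /=; under eq_Rintegral do rewrite mul1r.
by rewrite /Rintegral -/(nintegral mu (w i)) w1.
Qed.

Lemma rmeanD C D r q : 0 <= C -> 0 <= D -> ess_bounded mu C r -> ess_bounded mu D q ->
  rmean (fun x => r x + q x) = rmean r + rmean q.
Proof.
move=> C0 D0 bC bD.
apply: (rmean_eqP (addr_ge0 C0 D0) (ess_boundedD bC bD)).
rewrite (_ : (fun i => _) = fun i => \int[mu]_y (r y * w i y) + \int[mu]_y (q y * w i y)).
  by apply: cvgD; [exact: rmean_cvg bC|exact: rmean_cvg bD].
apply/funext => i; under eq_Rintegral do rewrite mulrDl.
rewrite RintegralD //.
- by have [] := ess_bounded_w i C0 bC.
- by have [] := ess_bounded_w i D0 bD.
Qed.

Lemma rmeanZ C a r : 0 <= C -> ess_bounded mu C r ->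
  rmean (fun x => a * r x) = a * rmean r.
Proof.
move=> C0 bC.
apply: (rmean_eqP (mulr_ge0 (normr_ge0 a) C0) (ess_boundedZ a bC)).
rewrite (_ : (fun i => _) = fun i => a * \int[mu]_y (r y * w i y)).
  by apply: cvgM; [exact: cvg_cst|exact: rmean_cvg bC].
apply/funext => i; under eq_Rintegral do rewrite -mulrA.
by rewrite RintegralZl //; have [] := ess_bounded_w i C0 bC.
Qed.

Lemma ess_bounded_translate C r (x : G) : ess_bounded mu C r ->
  ess_bounded mu C (fun y => r (x * y)%g).
Proof.
move=> [mr nr]; split; first exact: mfun_translate.
move=> K cK.
have [A [mA A0 hA]] := nr _ (ltrans_compact (x := x) cK).
exists ((fun y => x * y)%g @^-1` A); split.
- by rewrite -[X in measurable X]setTI; exact: measurable_mulgl.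
- by rewrite haar_preimage.
move=> y [/= h Ky]; apply: hA; split => //.
by rewrite /ltrans /= mulKg.
Qed.

(** Left invariance moves the translation from [r] onto [w i], and the L^1 distance between [w i]
    and its translate tends to 0. *)
Lemma rmean_translate C r (x : G) : 0 <= C -> ess_bounded mu C r ->
  rmean (fun y => r (x * y)%g) = rmean r.
Proof.
move=> C0 bC; have bCx := ess_bounded_translate x bC; have [mr _] := bC.
apply: (rmean_eqP C0 bCx).
rewrite (_ : (fun i => _) = fun i => \int[mu]_y (r y * w i y) +
   (\int[mu]_y (r y * (w i (x^-1 * y)%g - w i y)))); last first.
  apply/funext => i; have [mw _] := nw i.
  have mwx : measurable_fun [set: borel G] (fun y : borel G => w i (x^-1 * y)%g).
    exact: mfun_translate.
  have mp : measurable_fun [set: borel G] (fun y : borel G => r y * w i (x^-1 * y)%g).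
    exact: measurable_funM.
  have := integral_translate haar x mp; under eq_Rintegral do rewrite mulKg.
  move=> ->; under [X in _ = _ + X]eq_Rintegral do rewrite mulrBr.
  have [iw _] := ess_bounded_w i C0 bC.
  have [iwx _] : mu.-integrable [set: borel G] (EFin \o (fun y => r y * w i (x^-1 * y)%g)) /\
      `|\int[mu]_y (r y * w i (x^-1 * y)%g)| <= C * 1.
    have fE : nintegral mu (fun y => `|w i (x^-1 * y)%g|) = 1%E.
      rewrite (nintegral_translate haar x^-1%g (v := fun y => `|w i y|)).
        exact: nintegral_norm_w.
      exact: nonneg_mfun_norm.
    have := integral_ess_bounded hG haar C0 bC mwx; rewrite fE /=; apply; exact: ltry.
  by rewrite RintegralB // addrC subrK.
rewrite -[rmean r]addr0; apply: cvgD; first exact: rmean_cvg bC.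
apply/cvgrPdist_le => e e0.
(* [C] may be 0, hence the denominator [C + 1]. *)
have e1 : 0 < e / (C + 1) by rewrite divr_gt0 // ltr_wpDl.
apply: filterS (winv x^-1%g e1) => i hi /=.
rewrite sub0r normrN; have [mw _] := nw i.
have mwx : measurable_fun [set: borel G] (fun y : borel G => w i (x^-1 * y)%g - w i y).
  by apply: measurable_funB => //; exact: mfun_translate.
have [_ h] := integral_ess_bounded hG haar C0 bC mwx (le_lt_trans hi (ltry _)).
apply: le_trans h _.
set n := nintegral _ _ in hi *.
have fn : n \is a fin_num.
  by rewrite ge0_fin_numE ?(le_lt_trans hi (ltry _)) //; apply: nintegral_ge0.
move: hi; rewrite -[n]fineK // lee_fin /= => hi.
apply: le_trans (ler_wpM2l C0 hi) _.
by rewrite mulrA ler_pdivrMr ?ltr_wpDl // mulrC ler_wpM2l ?(ltW e0) // lerDl.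
Qed.

End Limit.
End Mean.

(** * The left invariant mean on complex functions *)

Section Amenability.
Context {R : realType} {G : topGroupType}.
Variable mu : {measure set (borel G) -> \bar R}.
Hypotheses (hG : hausdorff_space G) (haar : left_haar mu).
Implicit Types (r : borel G -> R) (f g : G -> R[i]) (C : R).

Lemma ess_bounded_modulus C f r : measurable_fun [set: borel G] r ->
  (forall x, `|r x| <= modulus f x) -> locally_null mu [set x | C < modulus f x] ->
  ess_bounded mu C r.
Proof.
move=> mr hr nf; split => // K cK; apply: negligibleS (nf K cK) => x [/= h Kx].
by split => //=; exact: lt_le_trans (hr x).
Qed.

Lemma Linfty_parts f : Linfty mu f -> exists C, [/\ 0 <= C,
  ess_bounded mu C (fun x => complex.Re (f x)) &
  ess_bounded mu C (fun x => complex.Im (f x))].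
Proof.
move=> [[mr mi] [C nC]]; exists (Num.max C 0); split.
- by rewrite le_max lexx orbT.
- apply: (@ess_boundedW _ _ _ C); first by rewrite le_max lexx.
  by apply: ess_bounded_modulus nC => // x; exact: normr_Re_le.
- apply: (@ess_boundedW _ _ _ C); first by rewrite le_max lexx.
  by apply: ess_bounded_modulus nC => // x; exact: normr_Im_le.
Qed.

Lemma LinftyP_bound C f : complex_measurable f ->
  (forall x, modulus f x <= C) -> Linfty mu f.
Proof.
move=> mf fC; split => //; exists C => K cK.
rewrite (_ : [set x | _] = set0) ?set0I; first exact: negligible_set0.
by apply/seteqP; split => // x /=; rewrite ltNge fC.
Qed.

Lemma reiter_amenable : reiter mu -> amenable mu.
Proof.
move=> /(reiter_ultra)[I [U [w [UU nw w1 winv]]]].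
pose M := rmean mu U w.
pose m f : R[i] := M (fun x => complex.Re (f x)) +i* M (fun x => complex.Im (f x)).
have MD C D r q : 0 <= C -> 0 <= D -> ess_bounded mu C r -> ess_bounded mu D q ->
    M (fun x => r x + q x) = M r + M q by exact: rmeanD.
have MZ C a r : 0 <= C -> ess_bounded mu C r -> M (fun x => a * r x) = a * M r.
  exact: rmeanZ.
have Mnorm C r : 0 <= C -> ess_bounded mu C r -> `|M r| <= C by exact: rmean_norm.
have Mcomb C r q a b : 0 <= C -> ess_bounded mu C r -> ess_bounded mu C q ->
    M (fun x => a * r x + b * q x) = a * M r + b * M q.
  move=> C0 bC bD.
  rewrite (MD (`|a| * C) (`|b| * C)); try exact: mulr_ge0; try exact: ess_boundedZ.
  by rewrite (MZ C) // (MZ C).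
have m_lin a f g : Linfty mu f -> Linfty mu g -> m (fun x => a * f x + g x) = a * m f + m g.
  move=> /Linfty_parts[C [C0 rC iC]] /Linfty_parts[D [D0 rD iD]].
  case: a => a b; rewrite /m.
  have E1 : (fun x => complex.Re ((a +i* b) * f x + g x)) =
      (fun x => (a * complex.Re (f x) + (- b) * complex.Im (f x)) + complex.Re (g x)).
    by apply/funext => x; case: (f x); case: (g x) => * /=; rewrite mulNr.
  have E2 : (fun x => complex.Im ((a +i* b) * f x + g x)) =
      (fun x => (a * complex.Im (f x) + b * complex.Re (f x)) + complex.Im (g x)).
    by apply/funext => x; case: (f x); case: (g x) => * /=.
  have bcomb p q (c d : R) : ess_bounded mu C p -> ess_bounded mu C q ->
      ess_bounded mu (`|c| * C + `|d| * C) (fun x => c * p x + d * q x).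
    by move=> bp bq; apply: ess_boundedD; exact: ess_boundedZ.
  have cd0 (c d : R) : 0 <= `|c| * C + `|d| * C by rewrite addr_ge0 // mulr_ge0.
  rewrite E1 E2 (MD _ _ _ _ (cd0 a (- b)) D0 (bcomb _ _ _ _ rC iC) rD).
  rewrite (MD _ _ _ _ (cd0 a b) D0 (bcomb _ _ _ _ iC rC) iD) !(Mcomb C) //.
  by apply/eqP; rewrite eq_complex /= mulNr !eqxx.
(* Bounding the two parts separately would lose a factor [sqrt 2], while the mean must have norm
   exactly 1. So [f] is rotated: the modulus [z] of [m f] is the mean of the real part of [f] times
   the conjugate of [m f / z], which Cauchy-Schwarz bounds by the modulus of [f]. *)
have m_bound C f : 0 <= C -> complex_measurable f ->
    locally_null mu [set x | C < modulus f x] -> Normc.normc (m f) <= C.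
  move=> C0 [mr mi] nC.
  set z := Normc.normc (m f).
  have [->//|z_neq0] := eqVneq z 0.
  have z0 : 0 < z by rewrite lt_def z_neq0 normc_ge0.
  set a := M (fun x => complex.Re (f x)); set b := M (fun x => complex.Im (f x)).
  have zE : z ^+ 2 = a ^+ 2 + b ^+ 2.
    by rewrite /z /m /= sqr_sqrtr // addr_ge0 ?sqr_ge0.
  have rC : ess_bounded mu C (fun x => complex.Re (f x)).
    by apply: ess_bounded_modulus nC => // x; exact: normr_Re_le.
  have iC : ess_bounded mu C (fun x => complex.Im (f x)).
    by apply: ess_bounded_modulus nC => // x; exact: normr_Im_le.
  have -> : z = M (fun x => a / z * complex.Re (f x) + b / z * complex.Im (f x)).
    rewrite (Mcomb C) // -/a -/b; apply: (mulfI z_neq0).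
    by rewrite -expr2 zE; field.
  apply: le_trans (ler_norm _) _; apply: Mnorm => //.
  apply: ess_bounded_modulus nC.
    by apply: measurable_funD; exact: measurable_funM.
  move=> x; rewrite /modulus; case: (f x) => p q /=.
  rewrite -sqrtr_sqr ler_sqrt ?addr_ge0 ?sqr_ge0 //.
  have -> : a / z * p + b / z * q = (a * p + b * q) / z by field.
  rewrite expr_div_n ler_pdivrMr ?exprn_gt0 // zE -subr_ge0.
  have -> : (p ^+ 2 + q ^+ 2) * (a ^+ 2 + b ^+ 2) - (a * p + b * q) ^+ 2 =
      (a * q - b * p) ^+ 2 by ring.
  exact: sqr_ge0.
have L1 : Linfty mu (fun=> 1 : R[i]).
  apply: (@LinftyP_bound 1); first by split; exact: measurable_cst.
  by move=> x; rewrite /modulus Normc.normc1.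
have m1 : m (fun=> 1) = 1.
  rewrite /m /= /M rmean1 //; apply/eqP; rewrite eq_complex /= eqxx /=.
  have := @Mnorm 0 (fun=> 0) (lexx 0); rewrite normr_le0; apply.
  split; first exact: measurable_cst.
  move=> K cK; rewrite (_ : [set x | _] = set0) ?set0I; first exact: negligible_set0.
  by apply/seteqP; split => // x /=; rewrite normr0 ltxx.
exists m; split.
- split => // f g Lf Lg fg.
  (* The difference vanishes off a locally null set, so [m_bound] applies with the constant 0. *)
  have hd : m (fun x => -1 * f x + g x) = 0.
    apply: Normc.eq0_normc; apply/eqP; rewrite eq_le normc_ge0 andbT.
    have [[mf _] [mg _]] := (Lf, Lg).
    apply: m_bound => //.
      by apply: complex_measurableD => //; apply: complex_measurableM.
    move=> K cK; apply: negligibleS (fg K cK) => x [/= h Kx]; split => // fgx.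
    by move: h; rewrite /modulus fgx mulN1r addNr Normc.normc0 ltxx.
  have := m_lin (-1) f g Lf Lg; rewrite hd mulN1r => /eqP.
  by rewrite eq_sym addrC subr_eq0 eq_sym => /eqP.
- move=> f Lf f0; have [C [C0 rC iC]] := Linfty_parts Lf.
  rewrite lecE /=; apply/andP; split.
    have -> : (fun x => complex.Im (f x)) = (fun x => 0 * complex.Im (f x)).
      by apply/funext => x; rewrite mul0r; have := f0 x; rewrite lecE => /andP[/eqP].
    by rewrite (MZ C) // mul0r.
  apply: rmean_ge0 rC _ => // x.
  by have := f0 x; rewrite lecE => /andP[].
- apply/eqP; rewrite eq_le; apply/andP; split.
    apply: ub_ereal_sup => _ [f [Lf f1] <-]; apply/lee_addgt0Pr => e e0.
    have [mf _] := Lf.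
    have : (ess_norm mu f < 1 + e%:E)%E.
      by apply: le_lt_trans f1 _; rewrite -EFinD lte_fin ltrDl.
    move=> /ereal_inf_lt [_ [C [C0 nC] <-] hC].
    apply: le_trans (ltW hC); rewrite lee_fin; exact: m_bound.
  apply: ereal_sup_ubound; exists (fun=> 1); last by rewrite m1 Normc.normc1.
  split => //; apply: ereal_inf_lbound; exists 1 => //; split => // K cK.
  rewrite (_ : [set x | _] = set0) ?set0I; first exact: negligible_set0.
  by apply/seteqP; split => // x /=; rewrite /modulus Normc.normc1 ltxx.
- move=> x f Lf; have [C [C0 rC iC]] := Linfty_parts Lf.
  rewrite /m; congr (_ +i* _).
    exact: (rmean_translate hG haar UU nw w1 winv x^-1%g C0 rC).
  exact: (rmean_translate hG haar UU nw w1 winv x^-1%g C0 iC).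
Qed.

Lemma compact_reiter : compact [set: G] -> reiter mu.
Proof.
move=> cG s e e0.
have [mu0 fin _ _ _] := haar.
have fG := compact_fin_num haar cG.
have c0 : 0 < fine (mu [set: G]) by rewrite -lte_fin fineK // lt_def mu0 /=.
exists (fun=> (fine (mu [set: G]))^-1); split.
- by apply: nonneg_mfun_cst; rewrite invr_ge0 ltW.
- rewrite /nintegral integral_cst // -[X in (_ * mu X)%E]/[set: G] -[mu _]fineK //.
  by rewrite -EFinM mulVf // gt_eqF.
move=> x _; rewrite /nintegral integral0_eq ?lee_fin ?ltW // => y _.
by rewrite subrr normr0.
Qed.

End Amenability.

(** * The lower bound on operator norms and the conclusion *)

Section Operators.
Context {R : realType} {G : topGroupType}.
Variable mu : {measure set (borel G) -> \bar R}.
Hypotheses (hG : hausdorff_space G) (haar : left_haar mu).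

(** Since the identity is a multiplier, surjectivity of [eta] puts it in the range. *)
Lemma id_multiplier (Phi Psi : R -> \bar R) (X : set (op R G)) :
  X `<=` PM_Psi mu Phi Psi -> multipliers mu Phi Psi X (fun T => T).
Proof.
move=> XPM; split => //.
- by move=> a S T _ _ f _; exact: ae_eq_refl.
- by exists 1 => T _; rewrite mul1e.
Qed.

Variables (k : R) (phi psi : R -> R).
Hypothesis (yphi : young_fun k phi) (ypsi : young_fun k psi).
Hypothesis (cpp : conj_fun phi psi) (k_gt0 : 0 < k).
Notation Phi := (EFin \o phi).
Notation Psi := (EFin \o psi).

Lemma norm_closure_span (S : set (op R G)) (T : op R G) : S T ->
  bounded_op mu Phi Psi T -> norm_closure mu Phi Psi (op_span S) T.
Proof.
move=> ST bT; split => // e e0.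
exists (fun f x => \sum_(i < 1) 1 * T f x).
  by exists 1%N, (fun=> 1), (fun=> T).
apply: (@le_lt_trans _ _ 0%E) => //; apply: ub_ereal_sup => _ [f _ <-].
apply: orlicz_norm_le => h _ _.
rewrite /nintegral integral0_eq // => y _.
by rewrite /modulus /op_sub big_ord1 mul1r subrr Normc.normc0 mul0r.
Qed.

Lemma conv_op_norm_ge (X : set (op R G)) (m : op R G -> R[i]) (C : R)
    (s : seq G) (nu : radon_cmeasure R G) :
  X `<=` PM_Psi mu Phi Psi -> X (conv_op nu) -> s != [::] ->
  (forall g, complex_measurable g -> conv_op nu g = cavg s g) ->
  is_odot mu Phi Psi m (conv_op nu) (conv_op nu) ->
  (forall T, A_dot mu Phi Psi X T ->
    ((Normc.normc (m T))%:E <= C%:E * op_norm mu Phi Psi T)%E) ->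
  (1 <= C%:E * op_norm mu Phi Psi (conv_op nu))%E.
Proof.
move=> XPM XT s0 convE [PMT modot] mC; set T := conv_op nu in XT PMT modot *.
have hT h : orlicz_space mu Psi h -> T h = cavg s h by move=> [mh _]; exact: convE.
have [u Au u1] := A_Phi_eq1 hG haar yphi ypsi cpp k_gt0 s.
(* Pairings with [T] see only values on [s], where [u] is 1. This also puts [T] in [A_dot X], where
   [m] is bounded. *)
have uT : is_action mu Phi Psi u T T.
  split => // v Av Auv.
  rewrite !(pairing_avg haar yphi ypsi cpp k_gt0 hT) //; congr (_ * _).
  by apply: eq_big_seq => x xs; rewrite u1 // mul1r.
have mT : m T = 1.
  rewrite -(modot u T Au uT) (pairing_avg haar yphi ypsi cpp k_gt0 hT) //.
  rewrite (eq_big_seq (fun=> 1)) => [|x xs]; last exact: u1.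
  rewrite big_const_seq count_predT iter_addr addr0 -(rmorph_nat (real_complex R)).
  by rewrite -rmorphM mulVf ?rmorph1 // pnatr_eq0 size_eq0.
have := mC T; rewrite mT Normc.normc1; apply.
apply: norm_closure_span; last by case: PMT.
by exists u, T.
Qed.

End Operators.

Theorem theorem3p5 (R : realType) (G : topGroupType)
  (mu : {measure set (borel G) -> \bar R}) (Phi Psi : R -> \bar R)
  (X : set (op R G)) :
  hausdorff_space G -> locally_compact [set: G] -> left_haar mu ->
  complementary_pair Phi Psi ->
  delta2 G Phi -> delta2 G Psi ->
  milnes_akimovic Phi -> milnes_akimovic Psi ->
  closed_subspace mu Phi Psi X ->
  topologically_invariant mu Phi Psi X ->
  (forall nu : radon_cmeasure R G, probability_cmeasure nu -> X (conv_op nu)) ->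
  (forall nu : radon_cmeasure R G, probability_cmeasure nu ->
     (op_norm mu Phi Psi (conv_op nu) <= 1)%E) ->
  (multipliers mu Phi Psi X `<=` eta_range mu Phi Psi X ->
     eta_range mu Phi Psi X (fun phi => phi)) /\
  (eta_range mu Phi Psi X (fun phi => phi) -> amenable mu).
Proof.
move=> hG lcG haar cPP d1 d2 _ _ [XPM _ _ _] _ Xprob _; split.
  by apply; exact: id_multiplier.
move=> [_ [m [_ [C mC]] modot]].
have [cG|ncG] := pselect (compact [set: G]).
  by apply: reiter_amenable => //; exact: compact_reiter.
apply: contrapT => nam.
have nr : ~ reiter mu by move=> /(reiter_amenable hG haar).
have [k [phi [psi [k0 [PhiE PsiE] yphi ypsi cpp]]]] := young_pair_fine ncG cPP d1 d2.
subst Phi Psi.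
(* [C] may be negative or 0. With [D >= C] positive and operator norm at most [(2 * D)^-1], the
   quantity bounded below by 1 is at most 1/2. *)
pose D := Num.max C 1.
have D0 : 0 < D by rewrite lt_max ltr01 orbT.
have c0 : 0 < (2 * D)^-1 by rewrite invr_gt0 mulr_gt0.
have [s s0 hs] := not_reiter_avg_small haar yphi ypsi cpp k0 nr c0.
have [nu [pnu convE]] := @uniform_measure R G hG s s0.
have XT := Xprob nu pnu.
have := conv_op_norm_ge hG haar yphi ypsi cpp k0 XPM XT s0 convE (modot _ XT) mC.
apply/negP; rewrite -ltNge.
have op_ge0 : (0 <= op_norm mu (EFin \o phi) (EFin \o psi) (conv_op nu))%E.
  apply: le_trans (ereal_sup_ubound _); last first.
    exists (fun=> 0) => //; split; first exact: (orlicz_space0 hG haar ypsi).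
    by rewrite (orlicz_norm0 mu yphi).
  exact: (orlicz_norm_ge0 mu yphi).
have op_le : (op_norm mu (EFin \o phi) (EFin \o psi) (conv_op nu) <= (2 * D)^-1%:E)%E.
  apply: ub_ereal_sup => _ [g [Lg g1] <-]; rewrite convE; last by case: Lg.
  exact: hs.
apply: (@le_lt_trans _ _ (D%:E * (2 * D)^-1%:E)%E).
  apply: (@le_trans _ _ (D%:E * op_norm mu (EFin \o phi) (EFin \o psi) (conv_op nu))%E).
    by rewrite lee_wpmul2r // lee_fin le_max lexx.
  by rewrite lee_wpmul2l // lee_fin ltW.
rewrite -EFinM lte_fin invfM mulrCA divff ?gt_eqF //.
by lra.
Qed.
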